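(* Let $(\mathfrak g,(\cdot|\cdot))$ be a finite-dimensional complex quadratic Lie algebra, $0\neq k\in\mathbb C$, and let $l,\overline l\subset\mathfrak g$ be isotropic subspaces with $l\cap\overline l=0$ such that $(\cdot|\cdot)$ restricted to $l\oplus\overline l$ is non-degenerate. Let $\varepsilon\in l\oplus\overline l$. Assume the F-term equation $$[l,l]\subset l,\qquad[\overline l,\overline l]\subset\overline l,$$ the D-term equation $$\frac12\sum_{j=1}^{\dim l}[\epsilon_j,\overline\epsilon_j]=\varepsilon_{\overline l}-\varepsilon_l,$$ and that $\varepsilon$ is holomorphic, i.e. $[\varepsilon,l]\subset l$ and $[\varepsilon,\overline l]\subset\overline l$. Put $e=\Pi\varepsilon$ and $u=\Pi(\varepsilon_l-\varepsilon_{\overline l})$. Then the vectors $$J=\frac ik:e^je_j:-\frac2kS\,iu,$$ $$H=\frac1k\big(:e_j(Se^j):+:e^j(Se_j):\big)+\frac1{k^2}\big(:e_j:e^k[e^j,e_k]::+:e^j:e_k[e_j,e^k]::-:e_j:e_k[e^j,e^k]::-:e^j:e^k[e_j,e_k]::\big)$$ induce an embedding of the $N=2$ superconformal vertex algebra with central charge $$c=3\Big(\dim l+\frac4k(e|e)\Big)$$ into the universal superaffine vertex algebra $V^k(\mathfrak g_{\rm super})$ with level $k$.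
   Context: SUSY vertex algebras. $\mathbb C$ is an algebraically closed field of characteristic $0$, $i=\sqrt{-1}$. A SUSY Lie conformal algebra is a superspace $\mathcal R$ with an odd endomorphism $S$, $T:=S^2$, and a parity-reversing bilinear $\Lambda$-bracket $[a_\Lambda b]$ with values in polynomials in $\Lambda=(\lambda,\chi)$ with coefficients in $\mathcal R$, where $\lambda$ is even, $\chi$ is odd, $\lambda\chi=\chi\lambda$, $\chi^2=-\lambda$, $S\lambda=\lambda S$, $S\chi+\chi S=2\lambda$, such that $[Sa_\Lambda b]=\chi[a_\Lambda b]$, $[a_\Lambda Sb]=-(-1)^{|a|}(S+\chi)[a_\Lambda b]$, $[a_\Lambda b]=(-1)^{|a||b|}[b_{-\Lambda-\nabla}a]$ with $\nabla=(T,S)$, and $[a_\Lambda[b_\Gamma c]]=(-1)^{|a|+1}[[a_\Lambda b]_{\Lambda+\Gamma}c]+(-1)^{(|a|+1)(|b|+1)}[b_\Gamma[a_\Lambda c]]$. A SUSY vertex algebra ($N_K=1$, in the sense of Heluani--Kac) is a SUSY Lie conformal algebra $V$ with an even vacuum $|0\rangle$ and an even normally ordered product $:ab:$ with unit $|0\rangle$, for which $S$ is an odd derivation, satisfying quasicommutativity $:ab:-(-1)^{|a||b|}:ba:=\int_{-\nabla}^0d\Lambda[a_\Lambda b]$, quasiassociativity $::ab:c:-:a:bc::=:(\int_0^\nabla d\Lambda\,a)[b_\Lambda c]:+(-1)^{|a||b|}:(\int_0^\nabla d\Lambda\,b)[a_\Lambda c]:$, and the non-commutative Wick formula $[a_\Lambda:bc:]=:[a_\Lambda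 b]c:+(-1)^{(|a|+1)|b|}:b[a_\Lambda c]:+\int_0^\Lambda d\Gamma[[a_\Lambda b]_\Gamma c]$. Here $\int d\Lambda$ means $\int d\lambda\,\partial_\chi$ (for $\int_0^\nabla$ in quasiassociativity, powers of $\Lambda$ from the bracket are put under the integral to the right of $a$, resp. $b$, and the right $\chi$-derivative is used). $:a:bc::$ means $:a(:bc:):$. Universal superaffine vertex algebra. A quadratic Lie algebra is a Lie algebra with a non-degenerate invariant symmetric bilinear form $(\cdot|\cdot)$. $\Pi\mathfrak g$ is the purely odd copy of $\mathfrak g$; $[\cdot,\cdot]$ and $(\cdot|\cdot)$ also denote the corresponding operations on $\Pi\mathfrak g$ (with $[\cdot,\cdot]$ valued in $\Pi\mathfrak g$). $V^k(\mathfrak g_{\rm super})$ is the universal enveloping SUSY vertex algebra of the SUSY Lie conformal algebra freely generated over $\mathbb C[S]$ by $\Pi\mathfrak g$ together with the central scalar $k$, with $[a_\Lambda b]=[a,b]+\chi k(a|b)$ for $a,b\in\Pi\mathfrak g$. Notation. $V_-=(l\oplus\overline l)^\perp$, so $\mathfrak g=l\oplus\overline l\oplus V_-$; $a_l,a_{\overline l},a_-$ are the components of $a$ and $a_+=a_l+a_{\overline l}$. $\{\epsilon_j\}$, $\{\overline\epsilon_j\}$ are bases of $l$, $\overline l$ with $(\epsilon_j|\overline\epsilon_k)=\delta_{jk}$; $e_j=\Pi\epsilon_j$, $e^j=\Pi\overline\epsilon_j$. Repeated indices are summed. All expressions are independent of the choice of these bases. $N=2$ superconformal vertex algebra of central charge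 $c$: the SUSY vertex algebra generated by an even $J$ and an odd $H$ with $[J_\Lambda J]=-(H+\tfrac{\lambda\chi}3c)$, $[H_\Lambda J]=(2T+2\lambda+\chi S)J$, $[H_\Lambda H]=(2T+\chi S+3\lambda)H+\tfrac{\chi\lambda^2}3c$. Vectors $J$ (even), $H$ (odd) of a SUSY vertex algebra are said to induce an embedding of it if they satisfy these three relations (so that there is a morphism of SUSY vertex algebras sending the generators to $J,H$). *)

(* Defs.v *)
From mathcomp Require Import all_boot all_algebra all_classical.

Set Implicit Arguments.
Unset Strict Implicit.
Unset Printing Implicit Defensive.

Import GRing.Theory.
Local Open Scope ring_scope.

Record quadraticLie (C : fieldType) := QuadraticLie {
  ql_carrier :> vectType C;
  qlie : ql_carrier -> ql_carrier -> ql_carrier;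
  qform : ql_carrier -> ql_carrier -> C;
  lie_linearl : forall y, linear (qlie^~ y);
  lie_linearr : forall x, linear (qlie x);
  lie_alt : forall x, qlie x x = 0;
  lie_jacobi : forall x y z,
    qlie x (qlie y z) = qlie (qlie x y) z + qlie y (qlie x z);
  form_linear : forall y, scalar (qform^~ y);
  form_sym : forall x y, qform x y = qform y x;
  form_invariant : forall x y z, qform (qlie x y) z = qform x (qlie y z);
  form_nondeg : forall x, (forall y, qform x y = 0) -> x = 0 }.

Definition isotropic (C : fieldType) (g : quadraticLie C) (l : {vspace g}) :=
  forall x y, x \in l -> y \in l -> qform x y = 0.

Definition nondeg_on (C : fieldType) (g : quadraticLie C) (U : {vspace g}) :=
  forall x, x \in U -> (forall y, y \in U -> qform x y = 0) -> x = 0.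

(* [stable_by x U] is [x, U] ⊂ U. *)
Definition stable_by (C : fieldType) (g : quadraticLie C) (x : g)
    (U : {vspace g}) :=
  forall y, y \in U -> qlie x y \in U.

(* Parities are booleans: [false] is even, [true] is odd. *)
Record superSpace (C : fieldType) := SuperSpace {
  ss_carrier :> lmodType C;
  homog : bool -> ss_carrier -> Prop;
  homog0 : forall p, homog p 0;
  homogP : forall p (c : C) v w,
    homog p v -> homog p w -> homog p (c *: v + w);
  homog_sum : forall v, exists v0 v1,
    [/\ homog false v0, homog true v1 & v = v0 + v1];
  homog_direct : forall v, homog false v -> homog true v -> v = 0 }.

(* The coefficients are written on the right: [p (n, j)] is the coefficient
   of λ^n χ^j in p = Σ λ^n χ^j p_(n,j), j = 0 or 1.  Finiteness of the support
   is not part of the type; it is the axiom [br_finite] for brackets.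
   [lpoly (lpoly V)] stands for V[Λ, Γ] with Λ outer and Γ = (γ, η) inner:
   [q m m'] is the coefficient of Λ^m Γ^m'.  The module structure is the
   pointwise one on functions. *)
Notation lpoly V := (nat * bool -> V)%type.

Definition lconst (V : zmodType) (v : V) : lpoly V :=
  fun m => if m == (0%N, false) then v else 0.

Definition lamM (V : zmodType) (p : lpoly V) : lpoly V :=
  fun m => if m.1 is n.+1 then p (n, m.2) else 0.

(* Left multiplication by χ: χ (λ^n χ v) = - λ^(n+1) v. *)
Definition chiM (V : zmodType) (p : lpoly V) : lpoly V :=
  fun m => if m.2 then p (m.1, false)
           else if m.1 is n.+1 then - p (n, true) else 0.

(* The action of S on V[Λ]: S (λ^n χ v) = 2 λ^(n+1) v - λ^n χ (S v). *)
Definition lS (V : zmodType) (S : V -> V) (p : lpoly V) : lpoly V :=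
  fun m => if m.2 then - S (p m)
           else S (p m) + (if m.1 is n.+1 then p (n, true) *+ 2 else 0).

(* The variables γ and η acting on V[Λ, Γ]; η anticommutes with χ. *)
Definition gamM (V : zmodType) (q : lpoly (lpoly V)) : lpoly (lpoly V) :=
  fun m => lamM (q m).

Definition etaM (C : fieldType) (V : lmodType C) (q : lpoly (lpoly V)) :
    lpoly (lpoly V) :=
  fun m => (-1) ^+ m.2 *: chiM (q m).

(* [lsubst L X f p] = Σ L^n X^j f(p_(n,j)), the substitution of the operators
   L, X for λ, χ after mapping the coefficients by f; a finite sum as soon as
   p has finite support and f 0 = 0, L 0 = 0, X 0 = 0. *)
Definition lsubst (C : fieldType) (V W : lmodType C) (L X : W -> W)
    (f : V -> W) (p : lpoly V) : W :=
  \sum_(m \in [set: nat * bool]) iter m.1 L (iter m.2 X (f (p m))).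

(* [lint0 L f p] = Σ_n L^(n+1)/(n+1) f(p_(n,1)) is ∫_0^L dλ ∂_χ f(p). *)
Definition lint0 (C : fieldType) (V W : lmodType C) (L : W -> W)
    (f : V -> W) (p : lpoly V) : W :=
  \sum_(n \in [set: nat]) n.+1%:R^-1 *: iter n.+1 L (f (p (n, true))).

(* Signs follow the Koszul rule with an odd bracket symbol standing to the
   left: [χ v_Γ c] = - χ [v_Γ c] and [a_Λ η v] = (-1)^(|a|+1) η [a_Λ v]. *)

(* [a_Λ [b_Γ c]] in V[Λ, Γ], where a has parity p. *)
Definition bracket_inr (C : fieldType) (V : lmodType C)
    (br : V -> V -> lpoly V) (p : bool) (a b c : V) : lpoly (lpoly V) :=
  lsubst (@gamM V) (fun q => (-1) ^+ p.+1 *: etaM q)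
    (fun v => (fun m => lconst (br a v m)) : lpoly (lpoly V)) (br b c).

(* [b_Γ [a_Λ c]] in V[Λ, Γ], where b has parity p. *)
Definition bracket_inr_swap (C : fieldType) (V : lmodType C)
    (br : V -> V -> lpoly V) (p : bool) (b a c : V) : lpoly (lpoly V) :=
  lsubst (@lamM (lpoly V)) (fun q => (-1) ^+ p.+1 *: chiM q)
    (fun v => lconst (br b v)) (br a c).

(* [[a_Λ b]_(Λ+Γ) c] *)
Definition bracket_inl_sum (C : fieldType) (V : lmodType C)
    (br : V -> V -> lpoly V) (a b c : V) : lpoly (lpoly V) :=
  lsubst (@lamM (lpoly V)) (fun q => - chiM q)
    (fun v => lsubst (fun q : lpoly (lpoly V) => lamM q + gamM q)
                     (fun q : lpoly (lpoly V) => chiM q + etaM q)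
                     (fun w => lconst (lconst w)) (br v c))
    (br a b).

(* [[a_Λ b]_Γ c] *)
Definition bracket_inl (C : fieldType) (V : lmodType C)
    (br : V -> V -> lpoly V) (a b c : V) : lpoly (lpoly V) :=
  lsubst (@lamM (lpoly V)) (fun q => - chiM q)
    (fun v => lconst (br v c)) (br a b).

(* ∫_0^Λ dΓ q = ∫_0^λ dγ ∂_η q; the sign is from moving ∂_η past χ. *)
Definition lint0_Lambda (C : fieldType) (V : lmodType C)
    (q : lpoly (lpoly V)) : lpoly V :=
  lsubst (@lamM V) (fun p => - chiM p)
    (fun p : lpoly V => lint0 (@lamM V) (@lconst V) p) q.

Record susyLCA (C : fieldType) := SusyLCA {
  lca_space :> superSpace C;
  SD : {linear lca_space -> lca_space};
  br : lca_space -> lca_space -> lpoly lca_space;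
  SD_odd : forall p v, homog p v -> homog (~~ p) (SD v);
  br_linearl : forall b, linear (br^~ b);
  br_linearr : forall a, linear (br a);
  br_finite : forall a b, exists N,
    forall n j, (N <= n)%N -> br a b (n, j) = 0;
  (* parity reversing, χ being odd *)
  br_parity : forall p q a b n j, homog p a -> homog q b ->
    homog (~~ (p (+) q (+) j)) (br a b (n, j));
  br_SDl : forall a b, br (SD a) b = chiM (br a b);
  br_SDr : forall p a b, homog p a ->
    br a (SD b) = - ((-1) ^+ p *: (lS SD (br a b) + chiM (br a b)));
  (* [a_Λ b] = (-1)^(|a||b|) [b_(-Λ-∇) a] *)
  br_skew : forall p q a b, homog p a -> homog q b ->
    br a b = (-1) ^+ (p * q) *:
      lsubst (fun r : lpoly lca_space => - (lamM r + lS SD (lS SD r)))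
             (fun r : lpoly lca_space => - (chiM r + lS SD r))
             (@lconst lca_space) (br b a);
  br_jacobi : forall p q a b c, homog p a -> homog q b ->
    bracket_inr br p a b c =
      (-1) ^+ p.+1 *: bracket_inl_sum br a b c
      + (-1) ^+ (p.+1 * q.+1) *: bracket_inr_swap br q b a c }.

Definition TD (C : fieldType) (R : susyLCA C) (v : R) : R := SD R (SD R v).

(* :(∫_0^∇ dΛ a) [b_Λ c]:  for the product [nop]. *)
Definition quasiassoc_term (C : fieldType) (R : susyLCA C)
    (nop : R -> R -> R) (a b c : R) : R :=
  \sum_(n \in [set: nat])
     n.+1%:R^-1 *: nop (iter n.+1 (@TD C R) a) (br b c (n, true)).

Record susyVA (C : fieldType) := SusyVA {
  va_lca :> susyLCA C;
  vac : va_lca;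
  nop : va_lca -> va_lca -> va_lca;
  vac_even : homog false vac;
  nop_linearl : forall b, linear (nop^~ b);
  nop_linearr : forall a, linear (nop a);
  nop_even : forall p q a b, homog p a -> homog q b ->
    homog (p (+) q) (nop a b);
  nop_vacl : forall a, nop vac a = a;
  nop_vacr : forall a, nop a vac = a;
  nop_SD : forall p a b, homog p a ->
    SD va_lca (nop a b) =
      nop (SD va_lca a) b + (-1) ^+ p *: nop a (SD va_lca b);
  (* :ab: - (-1)^(|a||b|) :ba: = ∫_(-∇)^0 dΛ [a_Λ b] *)
  nop_quasicomm : forall p q a b, homog p a -> homog q b ->
    nop a b - (-1) ^+ (p * q) *: nop b a =
      - lint0 (fun v => - TD v) id (br a b);
  nop_quasiassoc : forall p q a b c, homog p a -> homog q b ->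
    nop (nop a b) c - nop a (nop b c) =
      quasiassoc_term nop a b c
      + (-1) ^+ (p * q) *: quasiassoc_term nop b a c;
  (* in the second term :b (χ v): = (-1)^|b| χ :b v: *)
  nop_wick : forall p q a b c, homog p a -> homog q b ->
    br a (nop b c) =
      ((fun m => nop (br a b m) c) : lpoly va_lca)
      + (-1) ^+ (p.+1 * q) *:
          ((fun m => (-1) ^+ (q * m.2) *: nop b (br a c m)) : lpoly va_lca)
      + lint0_Lambda (bracket_inl (@br C va_lca) a b c) }.

Record lca_morphism (C : fieldType) (R R' : susyLCA C)
    (f : {linear R -> R'}) : Prop := LcaMorphism {
  lca_morphism_homog : forall p a, homog p a -> homog p (f a);
  lca_morphism_SD : forall a, f (SD R a) = SD R' (f a);
  lca_morphism_br : forall a b m, f (br a b m) = br (f a) (f b) m }.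

Record va_morphism (C : fieldType) (V W : susyVA C)
    (f : {linear V -> W}) : Prop := VaMorphism {
  va_morphism_lca : lca_morphism f;
  va_morphism_vac : f (vac V) = vac W;
  va_morphism_nop : forall a b, f (nop a b) = nop (f a) (f b) }.

(* R = (C[S] ⊗ Πg) ⊕ C K with [Πa_Λ Πb] = Π[a,b] + χ (a|b) K, where Pi is
   a |-> Πa. *)
Record superaffine_LCA (C : fieldType) (g : quadraticLie C) (R : susyLCA C)
    (Pi : {linear g -> R}) (K : R) : Prop := SuperaffineLCA {
  Pi_odd : forall a, homog true (Pi a);
  K_even : homog false K;
  K_SD : SD R K = 0;
  K_central : forall r, br K r = 0;
  superaffine_span : forall r : R, exists (s : seq g) (c : C),
    r = \sum_(n < size s) iter n (SD R) (Pi s`_n) + c *: K;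
  superaffine_free : forall (s : seq g) (c : C),
    \sum_(n < size s) iter n (SD R) (Pi s`_n) + c *: K = 0 ->
    (forall n, s`_n = 0) /\ c = 0;
  superaffine_br : forall a b,
    br (Pi a) (Pi b) = lconst (Pi (qlie a b)) + qform a b *: chiM (lconst K) }.

(* V, with iota : R -> V, is the universal enveloping SUSY vertex algebra of R
   in which the central element K is the scalar k, i.e. K is sent to k|0>. *)
Record enveloping_VA (C : fieldType) (R : susyLCA C) (K : R) (k : C)
    (V : susyVA C) (iota : {linear R -> V}) : Prop := EnvelopingVA {
  env_morphism : lca_morphism iota;
  env_level : iota K = k *: vac V;
  env_exists : forall (W : susyVA C) (phi : {linear R -> W}),
    lca_morphism phi -> phi K = k *: vac W ->
    exists f : {linear V -> W}, va_morphism f /\ f \o iota =1 phi;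
  env_unique : forall (W : susyVA C) (f1 f2 : {linear V -> W}),
    va_morphism f1 -> va_morphism f2 -> f1 \o iota =1 f2 \o iota ->
    f1 =1 f2 }.

(* V is V^k(g_super) and Pi : g -> V is a |-> Πa; both are only determined up
   to unique isomorphism. *)
Definition universal_superaffine_VA (C : fieldType) (g : quadraticLie C)
    (k : C) (V : susyVA C) (Pi : g -> V) : Prop :=
  exists (R : susyLCA C) (PiR : {linear g -> R}) (K : R)
         (iota : {linear R -> V}),
    [/\ superaffine_LCA PiR K, enveloping_VA K k iota & Pi =1 iota \o PiR].

Record N2_embedding (C : fieldType) (V : susyVA C) (J H : V) (c : C) : Prop :=
  N2Embedding {
  N2_J_even : homog false J;
  N2_H_odd : homog true H;
  N2_JJ : br J J =
    - (lconst H + (c / 3) *: lamM (chiM (lconst (vac V))));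
  N2_HJ : br H J =
    2 *: lconst (TD J) + 2 *: lamM (lconst J) + chiM (lconst (SD V J));
  N2_HH : br H H =
    2 *: lconst (TD H) + chiM (lconst (SD V H)) + 3 *: lamM (lconst H)
    + (c / 3) *: chiM (lamM (lamM (lconst (vac V)))) }.

(* Main.v *)
(** Let Q, P, R be the coefficients of 1, χ, λ in the operator x ↦ [J_Λ x].  Since
    J is even, the Jacobi identity for J, J, x reads
      [H_(Λ+Γ) x] = [J_Λ [J_Γ x]] + [J_Γ [J_Λ x]]
    once [J_Λ J] is known.  For x = J, the dependence on Λ + Γ alone forces [J_Λ H]
    to be of degree at most one, and skew-symmetry then gives 3 QH = S PH + T RH; for
    x = H the identity computes [H_Λ H].  Hence only [J_Λ J], PH = - SJ and RH = - 2J
    have to be checked.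

    On generators [J_Λ a] has no λ-term, so P is a derivation of the normally ordered
    product and R is a second-order operator, whose defect on a pair (a, b) is i times
    σ[a,b] - [σa,b] - [a,σb], where σ is 1 on l, -1 on lbar and 0 on V_-.  The values
    of P and R on the cubic term of H are contractions of alternating trilinear and
    bilinear maps over the dual bases E_j of l and F_j of lbar, which follow from
      Σ_m f([F_n,F_m], E_m) = - Σ_m f(F_m, [F_n,E_m]_l)
    and its mirror image. *)

(* The obstacle is that no hypothesis controls [l, lbar], so [E_j, F_k] may have a component in V_-.
   The contraction identities see only the projections of such brackets to l or lbar, while the
   unprojected sums come from Jacobi and the D-term equation. The two differ by multiples of
   [u, F_j] or [u, E_k], on which σ is -1 or 1 because ad u preserves lbar and l. The contractions
   thus reduce to five sums, and those that contain σ cancel in the combination occurring in H. The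
   term - (2/k) S iu of J has one source: contracting a generator a with both factors of Σ :e^j e_j:
   leaves the scalar 2k (a|u) in degree λ, and this term removes it. That is why [J_Λ a] has no
   λ-term. In the central charge, dim l is the trace of σ over the dual bases, and (e|e) = - (u|u)
   comes from the D-term equation. *)
Require Import Defs.
From HB Require Import structures.
From mathcomp Require Import all_boot all_algebra all_classical.
From mathcomp Require Import ring.

Set Implicit Arguments.
Unset Strict Implicit.
Unset Printing Implicit Defensive.

Import GRing.Theory.
Local Open Scope ring_scope.

(** * Linear combinations *)

(* A reflexive decision procedure for equalities between linear combinations:
   [lmod] reduces an equation in a module to the equality of the coefficients of
   each atom. *)
Inductive lexpr (C : Type) :=
  | LVar of nat
  | LZero
  | LAdd of lexpr C & lexpr C
  | LOpp of lexpr C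
  | LScale of C & lexpr C
  | LMuln of lexpr C & nat.

Section LinearCombinations.
Variables (C : pzRingType) (V : lmodType C).

Fixpoint leval (vs : seq V) (e : lexpr C) : V :=
  match e with
  | LVar n => nth 0 vs n
  | LZero => 0
  | LAdd a b => leval vs a + leval vs b
  | LOpp a => - leval vs a
  | LScale c a => c *: leval vs a
  | LMuln a n => leval vs a *+ n
  end.

Fixpoint lcoef (i : nat) (e : lexpr C) : C :=
  match e with
  | LVar n => if eqn n i then 1 else 0
  | LZero => 0
  | LAdd a b => lcoef i a + lcoef i b
  | LOpp a => - lcoef i a
  | LScale c a => c * lcoef i a
  | LMuln a n => lcoef i a *+ n
  end.

Fixpoint lcoef_eq (n : nat) (a b : lexpr C) : Prop :=
  if n is m.+1 then lcoef m a = lcoef m b /\ lcoef_eq m a b else True.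

Lemma levalE vs e : leval vs e = \sum_(i < size vs) lcoef i e *: vs`_i.
Proof.
elim: e => [n||a IHa b IHb|a IHa|c a IHa|a IHa n] /=; rewrite ?IHa ?IHb.
- have E i : lcoef i (LVar C n) = (n == i)%:R by rewrite /= -[eqn n i]/(n == i); case: eqP.
  under eq_bigr do rewrite -/(lcoef _ (LVar C n)) E.
  have [nvs|nvs] := ltnP n (size vs); last first.
    rewrite nth_default // big1 // => i _.
    by rewrite gtn_eqF ?scale0r // (leq_trans _ nvs).
  rewrite (bigD1 (Ordinal nvs)) //= eqxx scale1r big1 ?addr0 // => i ni.
  by rewrite eq_sym -val_eqE /= in ni *; rewrite (negPf ni) scale0r.
- by rewrite big1 // => i _; rewrite scale0r.
- by rewrite -big_split; apply: eq_bigr => i _; rewrite scalerDl.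
- by rewrite -sumrN; apply: eq_bigr => i _; rewrite scaleNr.
- by rewrite scaler_sumr; apply: eq_bigr => i _; rewrite scalerA.
- by rewrite -sumrMnl; apply: eq_bigr => i _; rewrite scalerMnl.
Qed.

Lemma lmod_correct vs a b :
  lcoef_eq (size vs) a b -> leval vs a = leval vs b.
Proof.
move=> ab; rewrite !levalE; apply: eq_bigr => -[i ivs] _ /=; congr (_ *: _).
elim: (size vs) ivs ab => // n IHn; rewrite ltnS leq_eqVlt => /orP[/eqP -> []//|].
by move=> lt_in [_]; apply: IHn.
Qed.

End LinearCombinations.

(** The nested [match constr:(tt)] runs the tactic [constr_eq] while a term is being built; its
    failure selects the next branch. Atoms are compared syntactically, so terms are brought to a
    common form before [lmod] is called. *)
Ltac lmod_find v vs :=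
  lazymatch vs with
  | ?w :: ?ws => match constr:(tt) with
    | _ => let _ := match constr:(tt) with _ => constr_eq v w end in constr:(0%N)
    | _ => let n := lmod_find v ws in constr:(S n)
    end
  end.

Ltac lmod_atoms t vs :=
  lazymatch t with
  | (?a + ?b)%R => let vs := lmod_atoms a vs in lmod_atoms b vs
  | (- ?a)%R => lmod_atoms a vs
  | (_ *: ?a)%R => lmod_atoms a vs
  | (?a *+ _)%R => lmod_atoms a vs
  | 0%R => vs
  | _ => match constr:(tt) with
    | _ => let _ := lmod_find t vs in vs
    | _ => constr:(t :: vs)
    end
  end.

Ltac lmod_reify C t vs :=
  lazymatch t with
  | (?a + ?b)%R => let x := lmod_reify C a vs in let y := lmod_reify C b vs in
                   constr:(LAdd x y)
  | (- ?a)%R => let x := lmod_reify C a vs in constr:(LOpp x)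
  | (?c *: ?a)%R => let x := lmod_reify C a vs in constr:(LScale c x)
  | (?a *+ ?n)%R => let x := lmod_reify C a vs in constr:(LMuln x n)
  | 0%R => constr:(@LZero C)
  | _ => let n := lmod_find t vs in constr:(@LVar C n)
  end.

Ltac lmod C :=
  lazymatch goal with
  | |- ?l = ?r :> ?T =>
    let vs := lmod_atoms l constr:(@nil T) in
    let vs := lmod_atoms r vs in
    let a := lmod_reify C l vs in
    let b := lmod_reify C r vs in
    refine (@lmod_correct C _ vs a b _);
    cbn [lcoef_eq lcoef eqn size]; repeat split
  end.

(** * Coefficients of Λ-brackets *)

HB.instance Definition _ (C : fieldType) (R : susyLCA C) (a : R) :=
  GRing.isLinear.Build C R (lpoly R) *:%R (@br C R a) (br_linearr a).
HB.instance Definition _ (C : fieldType) (V : susyVA C) (a : V) :=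
  GRing.isLinear.Build C V V *:%R (@nop C V a) (nop_linearr a).
HB.instance Definition _ (C : fieldType) (g : quadraticLie C) (x : g) :=
  GRing.isLinear.Build C g g *:%R (@qlie C g x) (lie_linearr x).

Section FiniteSums.
Variables (C : fieldType) (V W : lmodType C).

(** [N] is any bound on the degree, so that a caller can enlarge the range until it contains the
    exponent to be read off. The conditions at 0 make the terms beyond [N] vanish. *)
Lemma lsubstE (N : nat) (L X : W -> W) (f : V -> W) (p : lpoly V) :
  f 0 = 0 -> L 0 = 0 -> X 0 = 0 ->
  (forall n j, (N <= n)%N -> p (n, j) = 0) ->
  lsubst L X f p =
  \sum_(n < N) (iter n L (f (p (n : nat, false)))
                + iter n L (X (f (p (n : nat, true))))).
Proof.
move=> f0 L0 X0 pN.
have iter0 n : iter n L 0 = 0 by elim: n => //= n ->.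
rewrite /lsubst (@fsbigE _ _ _ _ _
  (allpairs (fun n j => (n, j)) (iota 0 N) [:: false; true])).
- rewrite big_mkcond; under eq_bigr do rewrite in_setT.
  rewrite big_allpairs_dep /= -[N in iota 0 N]subn0 big_mkord.
  by apply: eq_bigr => n _; rewrite !big_cons big_nil /= addr0.
- by apply: allpairs_uniq => //; [exact: iota_uniq | case=> ? ? [? ?] _ _ /= [-> ->]].
- by [].
- case=> n j _ /= nj; rewrite pN ?f0; last first.
    rewrite leqNgt; apply/negP => nN; case/negP: nj.
    by apply/flatten_mapP; exists n; rewrite ?mem_iota // !inE; case: j; rewrite eqxx ?orbT.
  by case: j {nj} => /=; rewrite ?X0 iter0.
Qed.

Lemma lint0E (N : nat) (L : W -> W) (f : V -> W) (p : lpoly V) :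
  f 0 = 0 -> L 0 = 0 -> (forall n, (N <= n)%N -> p (n, true) = 0) ->
  lint0 L f p = \sum_(n < N) n.+1%:R^-1 *: iter n.+1 L (f (p (n : nat, true))).
Proof.
move=> f0 L0 pN; rewrite /lint0 (@fsbigE _ _ _ _ _ (iota 0 N)) ?iota_uniq //.
  rewrite big_mkcond; under eq_bigr do rewrite in_setT.
  by rewrite -[N in iota 0 N]subn0 big_mkord.
move=> n _ /= nN; rewrite pN ?f0; last by rewrite mem_iota -leqNgt in nN.
have -> m : iter m L 0 = 0 by elim: m => //= m ->.
by rewrite L0 scaler0.
Qed.

End FiniteSums.

Section PointwiseSums.
Variables (V : zmodType).

Lemma sum_lpolyE (I : Type) (r : seq I) (P : pred I) (F : I -> lpoly V) m :
  (\sum_(i <- r | P i) F i) m = \sum_(i <- r | P i) F i m.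
Proof. by apply: (big_morph (fun f : lpoly V => f m)). Qed.

Lemma iter_lamM (p : lpoly V) n m j :
  iter n (@lamM V) p (m, j) = if (n <= m)%N then p ((m - n)%N, j) else 0.
Proof.
elim: n m => [|n IHn] m; first by rewrite subn0.
by rewrite iterS /lamM /=; case: m => // m; rewrite IHn subSS ltnS.
Qed.

Lemma lamM0 : lamM (0 : lpoly V) = 0.
Proof. by apply/funext => -[[|n] []]. Qed.

Lemma chiM0 : chiM (0 : lpoly V) = 0.
Proof. by apply/funext => -[[|n] []] //; exact: oppr0. Qed.

Lemma lconst0 : lconst (0 : V) = 0.
Proof. by apply/funext => m; rewrite /lconst; case: ifP. Qed.

End PointwiseSums.

Section BracketCoefficients.
Variables (C : fieldType) (R : susyLCA C).
Implicit Types a b c : R.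

Lemma brDl a b c m : br (a + b) c m = br a c m + br b c m.
Proof. by have := br_linearl c 1 a b; rewrite !scale1r => ->. Qed.

Lemma br0l c m : br 0 c m = 0.
Proof. by apply: (addrI (br 0 c m)); rewrite -brDl !addr0. Qed.

Lemma brZl (k : C) a c m : br (k *: a) c m = k *: br a c m.
Proof.
have := congr1 (@^~ m) (br_linearl c k a 0); rewrite /= addr0 => ->.
by rewrite -[LHS]/(k *: br a c m + br 0 c m) br0l addr0.
Qed.

Lemma brNl a c m : br (- a) c m = - br a c m.
Proof. by rewrite -scaleN1r brZl scaleN1r. Qed.

Lemma brDr a b c m : br a (b + c) m = br a b m + br a c m.
Proof. by rewrite linearD. Qed.

Lemma brZr (k : C) a c m : br a (k *: c) m = k *: br a c m.
Proof. by rewrite linearZ. Qed.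

Lemma brNr a c m : br a (- c) m = - br a c m.
Proof. by rewrite linearN. Qed.

Lemma br0r a m : br a 0 m = 0.
Proof. by rewrite linear0. Qed.

Lemma br_sumr (I : Type) (r : seq I) (P : pred I) (F : I -> R) a m :
  br a (\sum_(i <- r | P i) F i) m = \sum_(i <- r | P i) br a (F i) m.
Proof. by rewrite linear_sum sum_lpolyE. Qed.

Lemma homogD p a b : homog p a -> homog p b -> homog p (a + b).
Proof. by move=> pa pb; have := homogP 1 pa pb; rewrite scale1r. Qed.

Lemma homogZ p (k : C) a : homog p a -> homog p (k *: a).
Proof. by move=> pa; have := homogP k pa (homog0 _ p); rewrite addr0. Qed.

Lemma homogN p a : homog p a -> homog p (- a).
Proof. by move=> pa; rewrite -scaleN1r; apply: homogZ. Qed.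

Lemma homog_sumr p (I : Type) (r : seq I) (P : pred I) (F : I -> R) :
  (forall i, homog p (F i)) -> homog p (\sum_(i <- r | P i) F i).
Proof.
by move=> pF; elim/big_ind: _ => // [|a b]; [exact: homog0 | exact: homogD].
Qed.

Lemma br_SDl_true a b n : br (SD R a) b (n, true) = br a b (n, false).
Proof. by rewrite br_SDl. Qed.

Lemma br_SDl_false0 a b : br (SD R a) b (0%N, false) = 0.
Proof. by rewrite br_SDl. Qed.

Lemma br_SDr_true p a b n : homog p a ->
  br a (SD R b) (n, true) =
  (-1) ^+ p *: (SD R (br a b (n, true)) - br a b (n, false)).
Proof.
move=> pa; rewrite (br_SDr _ pa).
rewrite -[LHS]/(- ((-1) ^+ p *: (- SD R (br a b (n, true)) + br a b (n, false)))).
by rewrite -scalerN opprD opprK.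
Qed.

Lemma br_SDr_false0 p a b : homog p a ->
  br a (SD R b) (0%N, false) = - ((-1) ^+ p *: SD R (br a b (0%N, false))).
Proof.
move=> pa; rewrite (br_SDr _ pa).
rewrite -[LHS]/(- ((-1) ^+ p *: (SD R (br a b (0%N, false)) + 0 + 0))).
by rewrite !addr0.
Qed.

Lemma br_SDr_falseS p a b n : homog p a ->
  br a (SD R b) (n.+1, false) =
  - ((-1) ^+ p *: (SD R (br a b (n.+1, false)) + br a b (n, true))).
Proof.
move=> pa; rewrite (br_SDr _ pa).
rewrite -[LHS]/(- ((-1) ^+ p *: (SD R (br a b (n.+1, false))
   + br a b (n, true) *+ 2 - br a b (n, true)))).
by rewrite mulr2n addrA addrK.
Qed.

(* The coefficients of [b_(-Λ-∇) a] when [b_Λ a] = p_00 + χ p_01 + λ p_10. *)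
Lemma br_skew_low p q a b : homog p a -> homog q b ->
  (forall n j, (n, j) \notin [:: (0%N, false); (0%N, true); (1%N, false)] ->
     br b a (n, j) = 0) ->
  [/\ br a b (0%N, false) = (-1) ^+ (p * q) *: (br b a (0%N, false)
        - SD R (br b a (0%N, true)) - TD (br b a (1%N, false))),
      br a b (0%N, true) = - ((-1) ^+ (p * q) *: br b a (0%N, true)),
      br a b (1%N, false) = - ((-1) ^+ (p * q) *: br b a (1%N, false)) &
      forall n j, (n, j) \notin [:: (0%N, false); (0%N, true); (1%N, false)] ->
        br a b (n, j) = 0].
Proof.
move=> pa qb low.
have lS0 : lS (SD R) (0 : lpoly R) = 0.
  apply/funext => -[[|n] []].
  - by rewrite -[LHS]/(- SD R 0) linear0 oppr0.
  - by rewrite -[LHS]/(SD R 0 + 0) linear0 addr0.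
  - by rewrite -[LHS]/(- SD R 0) linear0 oppr0.
  - by rewrite -[LHS]/(SD R 0 + (0 : R) *+ 2) linear0 mul0rn addr0.
have lS_lconst v : lS (SD R) (lconst v) = lconst (SD R v).
  by apply/funext => -[[|n] []]; rewrite /lS /lconst /= ?[(n, true) == _]xpair_eqE ?andbF /= ?mul0rn ?linear0 ?oppr0 ?addr0.
have E : br a b = (-1) ^+ (p * q) *: (lconst (br b a (0%N, false))
     - (chiM (lconst (br b a (0%N, true))) + lconst (SD R (br b a (0%N, true))))
     - (lamM (lconst (br b a (1%N, false))) + lconst (TD (br b a (1%N, false))))).
  have low2 n j : (2 <= n)%N -> br b a (n, j) = 0.
    by move=> n2; apply: low; move: n2; case: n => [|[|n]].
  rewrite (br_skew pa qb) (lsubstE _ _ _ low2) ?lconst0 //; first last.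
    by rewrite chiM0 lS0 addr0 oppr0.
    by rewrite lamM0 !lS0 addr0 oppr0.
  rewrite !big_ord_recl big_ord0 /= (low 1%N true) // lconst0 !lS_lconst.
  congr (_ *: _); rewrite addr0.
  by rewrite chiM0 lS0 addr0 oppr0 lamM0 !lS0 addr0 oppr0 addr0.
have at_ m : br a b m = (-1) ^+ (p * q) *: (lconst (br b a (0%N, false)) m
     - (chiM (lconst (br b a (0%N, true))) m + lconst (SD R (br b a (0%N, true))) m)
     - (lamM (lconst (br b a (1%N, false))) m
        + lconst (TD (br b a (1%N, false))) m)) by rewrite E.
split=> [|||n j nj].
- by rewrite at_ /lconst /chiM /lamM /= !add0r.
- by rewrite at_ /lconst /chiM /lamM /= add0r !addr0 oppr0 addr0 scalerN.
- by rewrite at_ /lconst /chiM /lamM /= oppr0 addr0 oppr0 !addr0 add0r scalerN.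
- by rewrite at_; move: nj; case: n => [|[|n]]; case: j => //= _;
    rewrite /lconst /chiM /lamM /= ?(oppr0, addr0, scaler0).
Qed.

End BracketCoefficients.

(** * Coefficients in two variables and the Jacobi identity *)

Section TwoVariables.
Variables (C : fieldType) (R : susyLCA C).
Implicit Types a b c : R.

(** Reads off the coefficient of λ^m in Σ_n λ^n F_n, the shape to which the substitution sums below
    are brought. *)
Lemma sum_lconst_lamM (V : zmodType) N (F : nat -> V) m :
  (m < N)%N ->
  \sum_(n < N) (if (n <= m)%N then lconst (F n) ((m - n)%N, false) else 0) = F m.
Proof.
move=> mN; rewrite (bigD1 (Ordinal mN)) //= leqnn subnn /lconst eqxx.
rewrite big1 ?addr0 // => n nm; case: ifP => // le_nm.
rewrite xpair_eqE subn_eq0 eqxx andbT ifN //.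
by apply: contraNN nm => le_mn; rewrite -val_eqE /= eqn_leq le_nm le_mn.
Qed.

Lemma lconst_true (V : zmodType) (v : V) n : lconst v (n, true) = 0.
Proof. by rewrite /lconst xpair_eqE andbF. Qed.

Lemma br_bounded a b N : exists2 M, (N <= M)%N &
  forall n j, (M <= n)%N -> br a b (n, j) = 0.
Proof.
have [N0 bN0] := br_finite a b; exists (maxn N N0); first exact: leq_maxl.
by move=> n j; rewrite geq_max => /andP[_]; apply: bN0.
Qed.

Lemma bracket_inlE a b c :
  bracket_inl (@br C R) a b c = fun M => (-1) ^+ M.2 *: br (br a b M) c.
Proof.
apply/funext => -[m j]; have [N mN bN] := br_bounded a b m.+1.
rewrite /bracket_inl (lsubstE _ _ _ bN) ?lamM0 ?chiM0 ?oppr0 //; last first.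
  by apply/funext => M; rewrite /lconst (_ : br 0 c = 0) ?if_same //; apply/funext => ?; exact: br0l.
rewrite sum_lpolyE.
have E n :
  (iter n (@lamM (lpoly R)) (lconst (br (br a b (n, false)) c))
   + iter n (@lamM (lpoly R)) (- chiM (lconst (br (br a b (n, true)) c)))) (m, j)
  = if (n <= m)%N then lconst ((-1) ^+ j *: br (br a b (n, j)) c) ((m - n)%N, false) else 0.
  rewrite -[LHS]/(_ (m, j) + _ (m, j)) !iter_lamM.
  case: ifP => _; last by rewrite addr0.
  case: j; rewrite -[X in _ + X]/(- chiM _ _) /chiM /=.
    by rewrite lconst_true add0r /lconst; case: ifP => _; rewrite ?oppr0 // scaleN1r.
  by case: (m - n)%N => [|k]; rewrite ?lconst_true ?oppr0 ?addr0 // scale1r.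
rewrite (eq_bigr _ (fun (n : 'I_N) _ => E n)).
by rewrite (sum_lconst_lamM (fun n => (-1) ^+ j *: br (br a b (n, j)) c)).
Qed.

(** The integral turns λ^n χ into λ^(n+1) / (n+1), so the degree 0 part and the odd part of the
    result vanish. *)
Lemma lint0_lamM N (p : lpoly R) m j :
  (forall n, (N <= n)%N -> p (n, true) = 0) ->
  lint0 (@lamM R) (@lconst R) p (m, j) =
  if m is n.+1 then if j then 0 else n.+1%:R^-1 *: p (n, true) else 0.
Proof.
move=> pN; pose N' := maxn N m.
have pN' n : (N' <= n)%N -> p (n, true) = 0.
  by rewrite geq_max => /andP[/pN].
rewrite (lint0E (lconst0 _) (lamM0 _) pN') sum_lpolyE.
have E (n : nat) :
    (n.+1%:R^-1 *: iter n.+1 (@lamM R) (lconst (p (n, true)))) (m, j)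
    = if m is k.+1 then if (n <= k)%N then
        lconst (if j then 0 else n.+1%:R^-1 *: p (n, true)) ((k - n)%N, false)
      else 0 else 0.
  rewrite -[LHS]/(n.+1%:R^-1 *: (iter n.+1 _ _ (m, j))) iter_lamM.
  case: m {N' pN'} => [|k]; first by rewrite scaler0.
  rewrite ltnS subSS; case: ifP => _; last by rewrite scaler0.
  case: j; first by rewrite lconst_true scaler0 lconst0.
  by rewrite /lconst; case: ifP => _; rewrite ?scaler0.
rewrite (eq_bigr _ (fun (n : 'I_N') _ => E n)).
case: m @N' pN' E => [|k] N' pN' E; first by rewrite big1.
rewrite (sum_lconst_lamM (fun n => if j then 0 else n.+1%:R^-1 *: p (n, true))) //.
by rewrite leq_max leqnn orbT.
Qed.

(** A term λ^n χ^j γ^r η integrates to λ^(n+r+1) χ^j / (r+1); degree m is reached for r = m - n - 1,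
    hence n < m. The sign comes from ∂_η passing χ^j. *)
Lemma lint0_LambdaE N (q : lpoly (lpoly R)) m j :
  (forall n j, (N <= n)%N -> q (n, j) = 0) ->
  (forall M, exists K, forall n, (K <= n)%N -> q M (n, true) = 0) ->
  lint0_Lambda q (m, j) =
  \sum_(n < m) (-1) ^+ j *: ((m - n)%:R^-1 *: q (n : nat, j) ((m - n).-1, true)).
Proof.
move=> qN qM; pose N' := maxn N m.
have qN' n i : (N' <= n)%N -> q (n, i) = 0.
  by rewrite geq_max => /andP[/qN].
have I0 : lint0 (@lamM R) (@lconst R) 0 = 0.
  by rewrite (@lint0E _ _ _ 0) ?lconst0 ?lamM0 ?big_ord0.
have IE M k i : lint0 (@lamM R) (@lconst R) (q M) (k, i) =
    if k is n.+1 then if i then 0 else n.+1%:R^-1 *: q M (n, true) else 0.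
  by have [K qK] := qM M; rewrite (lint0_lamM _ _ qK).
rewrite /lint0_Lambda (lsubstE _ _ _ qN') ?lamM0 ?chiM0 ?oppr0 //.
rewrite sum_lpolyE.
pose F n := (-1) ^+ j *: ((m - n)%:R^-1 *: q (n, j) ((m - n).-1, true)).
rewrite (big_ord_widen N' F) ?leq_maxr // [RHS]big_mkcond /=.
apply: eq_bigr => n _; move: (nat_of_ord n) => {}n; rewrite /F {F}.
rewrite -[LHS]/(_ (m, j) + _ (m, j)) !iter_lamM; case: (ltngtP n m) => [nm|mn|->].
- rewrite -[X in _ + X]/(- chiM _ _) /chiM /=.
  have := subn_gt0 n m; rewrite nm; case: (m - n)%N => // k _.
  case: j; rewrite !IE /= ?expr0 ?scale1r ?add0r ?scaleN1r //.
  by case: (k) => *; rewrite !oppr0 addr0.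
- by rewrite addr0.
- rewrite subnn -[X in _ + X]/(- chiM _ _) /chiM /=.
  by case: j; rewrite !IE ?oppr0 addr0.
Qed.


(** In the sign, η passes the odd bracket symbol and [a], then the power of χ in the outer
    variable. *)
Lemma bracket_inrE p a b c M M' :
  bracket_inr (@br C R) p a b c M M' =
  (-1) ^+ ((p.+1 + M.2) * M'.2) *: br a (br b c M') M.
Proof.
case: M' => m j; have [N mN bN] := br_bounded b c m.+1.
have iter_gamM n (q : lpoly (lpoly R)) : iter n (@gamM R) q M = iter n (@lamM R) (q M).
  by elim: n => //= n <-.
rewrite /bracket_inr (lsubstE _ _ _ bN); first last.
- apply/funext => m'; rewrite -[LHS]/((-1) ^+ p.+1 *: ((-1) ^+ m'.2 *: chiM (0 : lpoly R))).
  by rewrite chiM0 !scaler0.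
- by apply/funext => m'; exact: lamM0.
- by apply/funext => m'; rewrite linear0 lconst0.
rewrite sum_lpolyE sum_lpolyE.
pose F n := (-1) ^+ ((p.+1 + M.2) * j) *: br a (br b c (n, j)) M.
rewrite -[RHS](sum_lconst_lamM F mN); apply: eq_bigr => n _.
rewrite -[LHS]/(iter n (@gamM R) _ M (m, j) + iter n (@gamM R) _ M (m, j)).
rewrite !iter_gamM !iter_lamM; case: ifP => _; last by rewrite addr0.
rewrite -[X in _ + X]/((-1) ^+ p.+1 *: ((-1) ^+ M.2 *:
  chiM (lconst (br a (br b c (n : nat, true)) M)) ((m - n)%N, j))).
rewrite scalerA -exprD /F /chiM; case: j {F} => /=.
  rewrite lconst_true add0r muln1 /lconst.
  by case: ifP => // _; rewrite scaler0.
rewrite muln0 expr0 scale1r.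
by case: (m - n)%N => [|k]; rewrite ?lconst_true ?oppr0 scaler0 addr0.
Qed.

Lemma bracket_inr_swapE p a b c M M' :
  bracket_inr_swap (@br C R) p b a c M M' =
  (-1) ^+ (p.+1 * M.2) *: br b (br a c M) M'.
Proof.
case: M => m j; have [N mN bN] := br_bounded a c m.+1.
rewrite /bracket_inr_swap (lsubstE _ _ _ bN); first last.
- by rewrite chiM0 scaler0.
- exact: lamM0.
- by rewrite linear0 lconst0.
rewrite sum_lpolyE.
pose F n := (-1) ^+ (p.+1 * j) *: br b (br a c (n, j)).
rewrite -[RHS]/(F m M') -(sum_lconst_lamM F mN); congr (_ M').
apply: eq_bigr => n _; rewrite -[LHS]/(_ (m, j) + _ (m, j)) !iter_lamM.
case: ifP => _; last by rewrite addr0.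
rewrite -[X in _ + X]/((-1) ^+ p.+1 *:
  chiM (lconst (br b (br a c (n : nat, true)))) ((m - n)%N, j)).
rewrite /F /chiM; case: j {F} => /=.
  rewrite lconst_true add0r muln1 /lconst.
  by case: ifP => // _; rewrite scaler0.
rewrite muln0 expr0 scale1r.
by case: (m - n)%N => [|k]; rewrite ?lconst_true ?oppr0 scaler0 addr0.
Qed.

(** This is p(Λ + Γ) in V[Λ, Γ]. *)
Definition lpoly_shift (p : lpoly R) : lpoly (lpoly R) :=
  lsubst (fun q : lpoly (lpoly R) => lamM q + gamM q)
         (fun q : lpoly (lpoly R) => chiM q + etaM q)
         (fun w => lconst (lconst w)) p.

(** The binomial expansion of (λ + γ)^n up to degree 1 in γ. *)
Lemma iter_shift n (q : lpoly (lpoly R)) m i j :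
  (iter n (fun q : lpoly (lpoly R) => lamM q + gamM q) q (m, i) (0%N, j)
     = if (n <= m)%N then q ((m - n)%N, i) (0%N, j) else 0)
  /\ (iter n (fun q : lpoly (lpoly R) => lamM q + gamM q) q (m, i) (1%N, j)
     = (if (n <= m)%N then q ((m - n)%N, i) (1%N, j) else 0)
       + (if (n <= m.+1)%N then q ((m.+1 - n)%N, i) (0%N, j) *+ n else 0)).
Proof.
elim: n m => [|n IHn] m; first by rewrite !subn0 mulr0n addr0.
rewrite iterS; set Q := iter n _ q in IHn *; split.
  rewrite -[LHS]/(lamM Q (m, i) (0%N, j) + gamM Q (m, i) (0%N, j)).
  rewrite /lamM /gamM /= addr0; case: m => // m.
  by rewrite (IHn m).1 subSS ltnS.
rewrite -[LHS]/(lamM Q (m, i) (1%N, j) + Q (m, i) (0%N, j)) (IHn m).1.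
rewrite /lamM /= ltnS; case: m => [|m].
  rewrite ltn0 add0r !leqn0; case: n {Q IHn} => [|n] /=; last by rewrite !add0r ?addr0.
  by rewrite !add0r mulr1n.
rewrite (IHn m).2 subSS ltnS -addrA; congr (_ + _).
by rewrite subSS; case: ifP => _; rewrite ?addr0 // -mulrSr.
Qed.

Let LL (w : R) : lpoly (lpoly R) := lconst (lconst w).

Lemma lconst2E (w : R) m i n j : LL w (m, i) (n, j) =
  if [&& ~~ i, ~~ j & n == 0%N] then lconst w (m, false) else 0.
Proof.
rewrite /LL /lconst !xpair_eqE; case: i => /=; rewrite ?andbF //= andbT.
by case: ifP => /= _; rewrite ?xpair_eqE ?if_same // andbC; case: j.
Qed.

Lemma lconst2_etaE (w : R) m i n j :
  (chiM (LL w) + etaM (LL w)) (m, i) (n, j) =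
  if (i (+) j) && (n == 0%N) then lconst w (m, false) else 0.
Proof.
rewrite -[LHS]/(chiM (LL w) (m, i) (n, j) + (-1) ^+ i *: chiM (LL w (m, i)) (n, j)).
rewrite /chiM /=; case: i; rewrite /= ?scaleN1r ?scale1r.
  rewrite lconst2E /=; case: j; first by rewrite !lconst2E oppr0 addr0.
  by case: n => [|n]; rewrite ?lconst2E ?opprK ?oppr0 ?addr0.
rewrite [X in X + _](_ : _ = 0); last first.
  by case: m => // m; rewrite -[LHS]/(- LL w (m, true) (n, j)) lconst2E oppr0.
rewrite add0r; case: j; first by rewrite lconst2E.
by case: n => // n; rewrite lconst2E oppr0.
Qed.

(** The coefficient of γ is a derivative in λ. Together with the coefficient of η, it turns
    dependence on Λ + Γ alone into a bound on the degree. *)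
Lemma lpoly_shiftE (p : lpoly R) N : (forall n j, (N <= n)%N -> p (n, j) = 0) ->
  [/\ forall M, lpoly_shift p M (0%N, false) = p M,
      forall n, lpoly_shift p (n, false) (0%N, true) = p (n, true) &
      forall n, lpoly_shift p (n, false) (1%N, false) = p (n.+1, false) *+ n.+1].
Proof.
move=> pN.
(* The coefficient of λ^m γ comes from the exponent m + 1, which the range has to contain. *)
have E m i : lpoly_shift p (m, i) = \sum_(n < maxn N m.+2)
    (iter n (fun q : lpoly (lpoly R) => lamM q + gamM q) (LL (p (n : nat, false))) (m, i)
    + iter n (fun q : lpoly (lpoly R) => lamM q + gamM q)
       (chiM (LL (p (n : nat, true))) + etaM (LL (p (n : nat, true)))) (m, i)).
  rewrite /lpoly_shift (@lsubstE _ _ _ (maxn N m.+2)) ?sum_lpolyE //.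
  - by rewrite !lconst0.
  - by rewrite lamM0 add0r; apply/funext => m'; exact: lamM0.
  - rewrite chiM0 add0r; apply/funext => m'.
    by rewrite -[LHS]/((-1) ^+ m'.2 *: chiM (0 : lpoly R)) chiM0 scaler0.
  - by move=> n j; rewrite geq_max => /andP[/pN].
have m1N m : (m.+1 < maxn N m.+2)%N by rewrite leq_max ltnSn orbT.
have mN m : (m < maxn N m.+2)%N by apply: ltnW.
split.
- case=> m j; rewrite E sum_lpolyE -[RHS](sum_lconst_lamM (fun n => p (n, j)) (mN m)).
  apply: eq_bigr => n _; rewrite -[LHS]/(iter _ _ _ (m, j) _ + iter _ _ _ (m, j) _).
  rewrite (iter_shift _ _ _ _ _).1 (iter_shift _ _ _ _ _).1 lconst2_etaE lconst2E.
  by case: ifP => _; case: j; rewrite ?addr0 ?add0r.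
- move=> m; rewrite E sum_lpolyE -[RHS](sum_lconst_lamM (fun n => p (n, true)) (mN m)).
  apply: eq_bigr => n _; rewrite -[LHS]/(iter _ _ _ (m, _) _ + iter _ _ _ (m, _) _).
  rewrite (iter_shift _ _ _ _ _).1 (iter_shift _ _ _ _ _).1 lconst2_etaE lconst2E.
  by case: ifP => _; rewrite ?addr0 ?add0r.
- move=> m; rewrite E sum_lpolyE.
  rewrite -[RHS](sum_lconst_lamM (fun n => p (n, false) *+ n) (m1N m)).
  apply: eq_bigr => n _; rewrite -[LHS]/(iter _ _ _ (m, _) _ + iter _ _ _ (m, _) _).
  rewrite (iter_shift _ _ _ _ _).2 (iter_shift _ _ _ _ _).2 !lconst2_etaE !lconst2E /=.
  rewrite !if_same !add0r mul0rn if_same addr0.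
  by case: ifP => _ //; rewrite /lconst; case: ifP => //; rewrite mul0rn.
Qed.

(* Only the coefficient of [Λ^0] of [a_Λ b] contributes when the others are
   central. *)
Lemma bracket_inl_sumE a b c :
  (forall m, m != (0%N, false) -> br (br a b m) c = 0) ->
  bracket_inl_sum (@br C R) a b c = lpoly_shift (br (br a b (0%N, false)) c).
Proof.
move=> central; have [N N0 bN] := br_bounded a b 1.
have lpoly_shift0 : lpoly_shift 0 = 0.
  rewrite /lpoly_shift (@lsubstE _ _ _ 0) ?big_ord0 //.
  - by rewrite !lconst0.
  - by rewrite lamM0 add0r; apply/funext => m'; exact: lamM0.
  - rewrite chiM0 add0r; apply/funext => m'.
    by rewrite -[LHS]/((-1) ^+ m'.2 *: chiM (0 : lpoly R)) chiM0 scaler0.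
have iter0 n : iter n (@lamM (lpoly R)) 0 = 0 by elim: n => //= n ->; rewrite lamM0.
have br0 : br (0 : R) c = 0 by apply/funext => m; exact: br0l.
rewrite /bracket_inl_sum (lsubstE _ _ _ bN) ?lamM0 ?chiM0 ?oppr0 ?br0 //.
case: N N0 {bN} => // N _; rewrite big_ord_recl /= (central (0%N, true)) // -/(lpoly_shift _) -/(lpoly_shift _).
rewrite lpoly_shift0 chiM0 oppr0 addr0 big1 ?addr0 // => n _.
by rewrite !central // -/(lpoly_shift _) lpoly_shift0 chiM0 oppr0 !iter0 lamM0 addr0.
Qed.

Lemma br_jacobi_coef (p q : bool) a b c (M M' : nat * bool) : homog p a -> homog q b ->
  (forall m, m != (0%N, false) -> br (br a b m) c = 0) ->
  (-1) ^+ ((p.+1 + M.2) * M'.2) *: br a (br b c M') M =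
  (-1) ^+ p.+1 *: lpoly_shift (br (br a b (0%N, false)) c) M M'
  + (-1) ^+ (p.+1 * q.+1) *: ((-1) ^+ (q.+1 * M.2) *: br b (br a c M) M').
Proof.
move=> pa qb central; rewrite -bracket_inrE (br_jacobi _ pa qb).
by rewrite -bracket_inr_swapE -bracket_inl_sumE.
Qed.

End TwoVariables.

(** * Normally ordered products and the vacuum *)

Section NormallyOrderedProduct.
Variables (C : fieldType) (V : susyVA C).
Implicit Types a b c : V.

Lemma nopDl a b c : nop (a + b) c = nop a c + nop b c.
Proof. by have := nop_linearl c 1 a b; rewrite !scale1r. Qed.

Lemma nop0l c : nop 0 c = 0 :> V.
Proof. by apply: (addrI (nop 0 c)); rewrite -nopDl !addr0. Qed.

Lemma nopZl (k : C) a c : nop (k *: a) c = k *: nop a c.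
Proof. by have := nop_linearl c k a 0; rewrite /= addr0 nop0l addr0. Qed.

Lemma nopNl a c : nop (- a) c = - nop a c.
Proof. by rewrite -scaleN1r nopZl scaleN1r. Qed.

(** The integral term carries no sign: moving χ out of [χ v_Γ c] and moving ∂_η past χ give the same
    sign twice. *)
Lemma wick_coef p q a b c N j : homog p a -> homog q b ->
  br a (nop b c) (N, j) =
    nop (br a b (N, j)) c
    + (-1) ^+ (p.+1 * q + q * j) *: nop b (br a c (N, j))
    + \sum_(n < N) (N - n)%:R^-1 *: br (br a b (n : nat, j)) c ((N - n).-1, true).
Proof.
move=> pa qb; rewrite (nop_wick _ pa qb) bracket_inlE.
have [K bK] := br_finite a b.
rewrite -[LHS]/(nop (br a b (N, j)) c
   + (-1) ^+ (p.+1 * q) *: ((-1) ^+ (q * j) *: nop b (br a c (N, j)))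
   + lint0_Lambda (fun M => (-1) ^+ M.2 *: br (br a b M) c) (N, j)).
rewrite scalerA -exprD (@lint0_LambdaE _ _ K).
- congr (_ + _); apply: eq_bigr => n _.
  rewrite -[X in _ *: (_ *: X)]/((-1) ^+ j *: _ _) !scalerA mulrAC -signr_addb.
  by rewrite addbb mul1r.
- move=> n i nK; rewrite bK // (_ : br 0 c = 0) ?scaler0 //.
  by apply/funext => m; exact: br0l.
- move=> M; have [K' bK'] := br_finite (br a b M) c; exists K' => n nK.
  by rewrite -[LHS]/((-1) ^+ M.2 *: br (br a b M) c (n, true)) bK' ?scaler0.
Qed.

(** Without terms λ^(n+1) χ, the integral from -∇ to 0 is just T applied to the coefficient of χ. *)
Lemma quasicomm_low p q a b : homog p a -> homog q b ->
  (forall n, br a b (n.+1, true) = 0) ->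
  nop a b = (-1) ^+ (p * q) *: nop b a + TD (br a b (0%N, true)).
Proof.
move=> pa qb low; apply/eqP; rewrite addrC -subr_eq (nop_quasicomm pa qb).
rewrite (@lint0E _ _ _ 1) ?big_ord1 //=; last by case.
- by rewrite invr1 scale1r opprK.
- by rewrite /TD !linear0.
Qed.

Lemma SD_vac : SD V (vac V) = 0.
Proof.
have := nop_SD (vac V) (vac_even V); rewrite !nop_vacl nop_vacr expr0 scale1r.
by move/eqP; rewrite -subr_eq0 opprD addrA subrr sub0r oppr_eq0 => /eqP.
Qed.

(** Induction on the degree in λ: the Wick formula for the product of the vacuum with itself reads x
    = 2 x plus brackets with coefficients of lower degree, which vanish by induction. *)
Lemma br_vacr a : br a (vac V) = 0.
Proof.
have homog_br p b : homog p b -> br b (vac V) = 0.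
  move=> pb; apply/funext => -[N j].
  elim/ltn_ind: N => N IHN.
  have := wick_coef (vac V) N j pb (vac_even V).
  rewrite nop_vacl nop_vacr muln0 mul0n expr0 scale1r nop_vacl.
  rewrite big1 => [|n _]; last by rewrite IHN // br0l scaler0.
  rewrite addr0 => /eqP; rewrite -subr_eq0 opprD addrA subrr sub0r oppr_eq0.
  by move/eqP.
have [a0 [a1 [ha0 ha1 ->]]] := homog_sum a.
by apply/funext => m; rewrite brDl (homog_br _ _ ha0) (homog_br _ _ ha1) addr0.
Qed.

Lemma br_vacl a : br (vac V) a = 0.
Proof.
have homog_br p b : homog p b -> br (vac V) b = 0.
  move=> pb; have [] := br_skew_low (vac_even V) pb.
    by move=> n j _; rewrite br_vacr.
  have z m : br b (vac V) m = 0 by rewrite br_vacr.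
  rewrite !z /TD !linear0 => E0 E1 E2 E3.
  apply/funext => -[n j].
  have [|/E3 -> //] := boolP ((n, j) \in [:: (0%N, false); (0%N, true); (1%N, false)]).
  rewrite !inE => /or3P[] /eqP[-> ->]; rewrite ?E0 ?E1 ?E2.
  - by rewrite !addr0 scaler0.
  - by [].
  - by [].
have [a0 [a1 [ha0 ha1 ->]]] := homog_sum a.
by apply/funext => m; rewrite brDr (homog_br _ _ ha0) (homog_br _ _ ha1) addr0.
Qed.

End NormallyOrderedProduct.

(** * A criterion for N = 2 embeddings *)

Section N2Criterion.
Variables (C : fieldType) (C_char0 : [pchar C] =i pred0) (V : susyVA C).
Variables (J H : V) (c : C).
Hypotheses (J_even : homog false J) (H_odd : homog true H).
Hypothesis JJ : br J J = - (lconst H + (c / 3) *: lamM (chiM (lconst (vac V)))).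
Hypothesis JH01 : br J H (0%N, true) = - SD V J.
Hypothesis JH10 : br J H (1%N, false) = - (2 *: J).

Let natC_neq0 n : n.+1%:R != 0 :> C.
Proof. by rewrite (pcharf0P C).1. Qed.

Let JJE n j : br J J (n, j) =
  if j then if n == 1%N then - ((c / 3) *: vac V) else 0
  else if n == 0%N then - H else 0.
Proof.
rewrite JJ -[LHS]/(- (lconst H (n, j) + (c / 3) *: lamM (chiM (lconst (vac V))) (n, j))).
rewrite /lamM /chiM /=; case: j.
  by rewrite lconst_true /lconst; case: n => [|[|n]] /=; lmod C; ring.
by case: n => [|[|n]] /=; rewrite ?lconst_true /lconst /=; lmod C; ring.
Qed.

Let JJ_central x m : m != (0%N, false) -> br (br J J m) x = 0.
Proof.
have br0 : br (0 : V) x = 0 by apply/funext => ?; exact: br0l.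
case: m => n j; rewrite xpair_eqE JJE; case: j => /=; last by case: eqP.
move=> _; case: (n == 1%N) => //; apply/funext => m.
by rewrite brNl brZl br_vacl scaler0 oppr0.
Qed.

Let jacobi x (M M' : nat * bool) :
  (-1) ^+ ((1 + M.2) * M'.2) *: br J (br J x M') M =
  - lpoly_shift (br (- H) x) M M' - (-1) ^+ M.2 *: br J (br J x M) M'.
Proof.
rewrite (br_jacobi_coef M M' J_even J_even (@JJ_central x)) JJE /=.
by rewrite !expr1 !scaleN1r mul1n.
Qed.

Let lpoly_shiftH x := let: ex_intro N bN := br_finite (- H) x in lpoly_shiftE bN.

Let jacobi0 x (M : nat * bool) :
  br H x M = br J (br J x (0%N, false)) M
             + (-1) ^+ M.2 *: br J (br J x M) (0%N, false).
Proof.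
have [l00 _ _] := lpoly_shiftH x.
by have := jacobi x M (0%N, false); rewrite muln0 expr0 scale1r l00 brNl opprK => ->; rewrite addrNK.
Qed.

Let JJ_scalar m : m != (0%N, false) -> br J (br J J m) = 0.
Proof.
case: m => n j; rewrite xpair_eqE JJE; case: j => /=; last by case: eqP => //= _; rewrite linear0.
by move=> _; case: (n == 1%N); rewrite ?linear0 // linearN linearZ /= br_vacr scaler0 oppr0.
Qed.

Let HJ_JH m : m != (0%N, false) -> br H J m = - br J H m.
Proof.
by move=> m0; rewrite jacobi0 (JJ_scalar m0) scaler0 addr0 JJE /= brNr.
Qed.

(** At Λ = Γ = 0 the two Jacobi terms coincide, whence a factor 2 that is absent from [HJ_JH]. This
    asymmetry is what lets skew-symmetry determine the coefficient in [JH00]. *)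
Let HJ00 : br H J (0%N, false) = - (2 *: br J H (0%N, false)).
Proof. by rewrite jacobi0 /= expr0 scale1r JJE /= brNr -opprD scaler_nat mulr2n. Qed.

(** Compare the coefficients of λ^(n+1) η and λ^(n+1) γ. On the side of J they are brackets of J
    with coefficients of [J_Λ J] that vanish. In the second case the other side is (n + 2) times the
    wanted coefficient, and characteristic 0 allows division. *)
Let HJ_low n j : (n, j) \notin [:: (0%N, false); (0%N, true); (1%N, false)] ->
  br H J (n, j) = 0.
Proof.
have [_ l01 l10] := lpoly_shiftH J.
case: j; case: n => [|n] //.
  move=> _; have := jacobi J (n.+1, false) (0%N, true).
  rewrite l01 !JJE /= !br0r !scaler0 subr0 brNl opprK.
  by move/esym.
case: n => [|n] // _; have := jacobi J (n.+1, false) (1%N, false).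
rewrite l10 !JJE /= !br0r !scaler0 subr0 brNl -scaler_nat scalerN opprK.
by move/esym/eqP; rewrite scaler_eq0 (negPf (natC_neq0 _)) => /eqP.
Qed.

Let JH_low n j : (n, j) \notin [:: (0%N, false); (0%N, true); (1%N, false)] ->
  br J H (n, j) = 0.
Proof.
move=> nj; have := HJ_low nj; rewrite HJ_JH; last first.
  by apply: contraNN nj => /eqP ->; rewrite !inE eqxx.
by move/eqP; rewrite oppr_eq0 => /eqP.
Qed.

Let JH00 : br J H (0%N, false) = - TD J.
Proof.
have [+ _ _ _] := br_skew_low H_odd J_even JH_low.
have SN x : SD V (- x) = - SD V x by rewrite linearN.
have SZ k x : SD V (k *: x) = k *: SD V x by rewrite linearZ.
rewrite HJ00 JH01 JH10 muln0 expr0 scale1r /TD !SN !SZ.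
move/eqP; rewrite -subr_eq0 => /eqP E.
have : 3 *: (br J H (0%N, false) + TD J) = 0.
  by rewrite -oppr0 -E /TD; lmod C; ring.
by move/eqP; rewrite scaler_eq0 (negPf (natC_neq0 2)) /= addr_eq0 => /eqP.
Qed.

Let HJE : br H J =
  2 *: lconst (TD J) + 2 *: lamM (lconst J) + chiM (lconst (SD V J)).
Proof.
apply/funext => -[n j].
rewrite -[RHS]/(2 *: lconst (TD J) (n, j) + 2 *: lamM (lconst J) (n, j)
   + chiM (lconst (SD V J)) (n, j)).
have [|nj] := boolP ((n, j) \in [:: (0%N, false); (0%N, true); (1%N, false)]).
  rewrite !inE => /or3P[] /eqP[-> ->]; rewrite /lconst /lamM /chiM /=.
  - by rewrite HJ00 JH00; lmod C; ring.
  - by rewrite HJ_JH // JH01; lmod C; ring.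
  - by rewrite HJ_JH // JH10; lmod C; ring.
rewrite (HJ_low nj); move: nj; rewrite /lconst /lamM /chiM.
by case: j; case: n => [|[|n]] //= _; lmod C; ring.
Qed.

Let JSJE n j : br J (SD V J) (n, j) =
  if j then if n == 0%N then H else 0
  else if n == 0%N then SD V H else if n == 2 then (c / 3) *: vac V else 0.
Proof.
case: j.
  rewrite (br_SDr_true _ _ J_even) !JJE expr0 scale1r /=.
  by case: n => [|[|n]]; rewrite /= ?linearN ?linearZ /= ?SD_vac ?linear0 ?scaler0 ?opprK ?oppr0 ?add0r ?addr0.
case: n => [|n]; first by rewrite (br_SDr_false0 _ J_even) expr0 scale1r JJE linearN opprK.
rewrite (br_SDr_falseS _ _ J_even) !JJE expr0 scale1r /= linear0 add0r.
by case: n => [|[|n]]; rewrite /= ?opprK ?oppr0.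
Qed.

Let JTJE n j : br J (TD J) (n, j) =
  if j then if n == 2 then - ((c / 3) *: vac V) else 0
  else if n == 0%N then - TD H else if n == 1%N then - H else 0.
Proof.
rewrite /TD; case: j.
  rewrite (br_SDr_true _ _ J_even) !JSJE expr0 scale1r /=.
  by case: n => [|[|[|n]]]; rewrite /= ?subrr ?linear0 ?subr0 ?add0r.
case: n => [|n]; first by rewrite (br_SDr_false0 _ J_even) expr0 scale1r JSJE.
rewrite (br_SDr_falseS _ _ J_even) !JSJE expr0 scale1r /=.
by case: n => [|[|n]]; rewrite /= ?linearZ /= ?SD_vac ?linear0 ?scaler0 ?addr0 ?add0r ?oppr0.
Qed.

Let HHE : br H H =
  2 *: lconst (TD H) + chiM (lconst (SD V H)) + 3 *: lamM (lconst H)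
    + (c / 3) *: chiM (lamM (lamM (lconst (vac V)))).
Proof.
apply/funext => -[n j].
rewrite -[RHS]/(2 *: lconst (TD H) (n, j) + chiM (lconst (SD V H)) (n, j)
   + 3 *: lamM (lconst H) (n, j)
   + (c / 3) *: chiM (lamM (lamM (lconst (vac V)))) (n, j)).
(* The coefficients of [J_Λ H] are by now multiples of TJ, SJ and J, so everything is expressed by
   brackets of J with these three vectors. *)
rewrite jacobi0 JH00 brNr JTJE.
have [|nj] := boolP ((n, j) \in [:: (0%N, false); (0%N, true); (1%N, false)]).
  rewrite !inE => /or3P[] /eqP[-> ->]; rewrite /lconst /lamM /chiM /=.
  - by rewrite JH00 brNr JTJE /=; lmod C; ring.
  - by rewrite JH01 brNr JSJE /=; lmod C; ring.
  - by rewrite JH10 brNr brZr JJE /=; lmod C; ring.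
rewrite (JH_low nj) br0r scaler0 addr0; move: nj; rewrite /lamM /chiM.
by case: j; case: n => [|[|[|n]]] //= _; rewrite ?lconst_true /lconst /=; lmod C; ring.
Qed.

Lemma N2_embedding_low : N2_embedding J H c.
Proof. by split. Qed.

End N2Criterion.

(** * Contractions over dual bases of a quadratic Lie algebra *)

Section QuadraticLieAlgebras.
Variables (C : fieldType) (g : quadraticLie C).
Implicit Types x y z : g.

Lemma lieDl x y z : qlie (x + y) z = qlie x z + qlie y z.
Proof. by have := lie_linearl z 1 x y; rewrite !scale1r. Qed.

Lemma lie0l z : qlie 0 z = 0 :> g.
Proof. by apply: (addrI (qlie 0 z)); rewrite -lieDl !addr0. Qed.

Lemma lieZl (k : C) x z : qlie (k *: x) z = k *: qlie x z.
Proof. by have := lie_linearl z k x 0; rewrite /= addr0 lie0l addr0. Qed.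

Lemma lieNl x z : qlie (- x) z = - qlie x z.
Proof. by rewrite -[- x]scaleN1r lieZl scaleN1r. Qed.

Lemma lieDr x y z : qlie x (y + z) = qlie x y + qlie x z.
Proof. exact: linearD. Qed.

Lemma lieZr (k : C) x z : qlie x (k *: z) = k *: qlie x z.
Proof. exact: linearZ. Qed.

Lemma lie_suml (I : Type) (r : seq I) (P : pred I) (F : I -> g) y :
  qlie (\sum_(i <- r | P i) F i) y = \sum_(i <- r | P i) qlie (F i) y.
Proof. by apply: (big_morph (@qlie C g ^~ y)) => [a b|]; rewrite ?lieDl ?lie0l. Qed.

Lemma lie_sumr (I : Type) (r : seq I) (P : pred I) (F : I -> g) y :
  qlie y (\sum_(i <- r | P i) F i) = \sum_(i <- r | P i) qlie y (F i).
Proof. exact: linear_sum. Qed.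

Lemma lieNr x z : qlie x (- z) = - qlie x z.
Proof. exact: linearN. Qed.

Lemma lieC x y : qlie x y = - qlie y x.
Proof.
have := lie_alt (x + y); rewrite lieDl !lieDr !lie_alt add0r addr0 => /eqP.
by rewrite addr_eq0 => /eqP.
Qed.

Lemma lie_flip x y z : qlie (qlie x y) z = qlie z (qlie y x).
Proof. by rewrite lieC (lieC x y) linearN opprK. Qed.

Lemma qformDl x y z : qform (x + y) z = qform x z + qform y z.
Proof. by have := form_linear z 1 x y; rewrite scale1r mul1r. Qed.

Lemma qform0l z : qform (0 : g) z = 0.
Proof. by apply: (addrI (qform 0 z)); rewrite -qformDl !addr0. Qed.

Lemma qformZl (k : C) x z : qform (k *: x) z = k * qform x z.
Proof. by have := form_linear z k x 0; rewrite /= addr0 qform0l addr0. Qed.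

Lemma qformDr x y z : qform z (x + y) = qform z x + qform z y.
Proof. by rewrite form_sym qformDl !(form_sym z). Qed.

Lemma qformZr (k : C) x z : qform z (k *: x) = k * qform z x.
Proof. by rewrite form_sym qformZl (form_sym z). Qed.

Lemma qform_suml (I : Type) (r : seq I) (P : pred I) (F : I -> g) y :
  qform (\sum_(i <- r | P i) F i) y = \sum_(i <- r | P i) qform (F i) y.
Proof. by apply: (big_morph (@qform C g ^~ y)) => [a b|]; rewrite ?qformDl ?qform0l. Qed.

Lemma qform_sumr (I : Type) (r : seq I) (P : pred I) (F : I -> g) y :
  qform y (\sum_(i <- r | P i) F i) = \sum_(i <- r | P i) qform y (F i).
Proof. by rewrite form_sym qform_suml; apply: eq_bigr => i _; apply: form_sym. Qed.

Lemma qform_ad x y z : qform (qlie x y) z = - qform y (qlie x z).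
Proof. by rewrite lieC -scaleN1r qformZl form_invariant mulN1r. Qed.

(** For dual bases of isotropic l and lbar, this is the projection onto l along lbar ⊕ V_-. *)
Definition lproj d (E F : 'I_d -> g) x := \sum_j qform x (F j) *: E j.

Lemma lproj_linear d (E F : 'I_d -> g) : linear (lproj E F).
Proof.
move=> k x y; rewrite /lproj scaler_sumr -big_split; apply: eq_bigr => j _.
by rewrite /= qformDl qformZl scalerDl scalerA.
Qed.

HB.instance Definition _ d (E F : 'I_d -> g) :=
  GRing.isLinear.Build C g g *:%R (lproj E F) (@lproj_linear d E F).

Definition bilinear_map (W : lmodType C) (f : g -> g -> W) :=
  (forall y, linear (f^~ y)) /\ (forall x, linear (f x)).

Section BilinearMaps.
Variables (W : lmodType C) (f : g -> g -> W) (bf : bilinear_map f).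

Lemma bilinear_Dl x y z : f (x + y) z = f x z + f y z.
Proof. by have := bf.1 z 1 x y; rewrite !scale1r. Qed.

Lemma bilinear_0l z : f 0 z = 0.
Proof. by apply: (addrI (f 0 z)); rewrite -bilinear_Dl !addr0. Qed.

Lemma bilinear_Zl c x z : f (c *: x) z = c *: f x z.
Proof. by have := bf.1 z c x 0; rewrite /= addr0 bilinear_0l addr0. Qed.

Lemma bilinear_suml d (c : 'I_d -> C) (E : 'I_d -> g) z :
  f (\sum_j c j *: E j) z = \sum_j c j *: f (E j) z.
Proof.
elim/big_rec2: _ => [|j _ x _ <-]; first exact: bilinear_0l.
by rewrite bilinear_Dl bilinear_Zl.
Qed.

Lemma bilinear_flip : bilinear_map (fun x y => f y x).
Proof. by case: bf. Qed.

End BilinearMaps.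

Section BilinearMapsRight.
Variables (W : lmodType C) (f : g -> g -> W) (bf : bilinear_map f).

Lemma bilinear_Dr x y z : f z (x + y) = f z x + f z y.
Proof. exact: (bilinear_Dl (bilinear_flip bf)). Qed.

Lemma bilinear_Zr c x z : f z (c *: x) = c *: f z x.
Proof. exact: (bilinear_Zl (bilinear_flip bf)). Qed.

Lemma bilinear_sumr d (c : 'I_d -> C) (E : 'I_d -> g) z :
  f z (\sum_j c j *: E j) = \sum_j c j *: f z (E j).
Proof. exact: (bilinear_suml (bilinear_flip bf)). Qed.

End BilinearMapsRight.

(* Invariance of [Σ_j F_j ⊗ E_j] under a skew-symmetric [phi] that preserves
   the span of the [F_j] only. *)
Lemma skew_contract (W : lmodType C) (f : g -> g -> W) d (E F : 'I_d -> g)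
    (phi : g -> g) :
  bilinear_map f -> (forall x y, qform (phi x) y = - qform x (phi y)) ->
  (forall j, lproj F E (phi (F j)) = phi (F j)) ->
  \sum_j f (phi (F j)) (E j) = - \sum_j f (F j) (lproj E F (phi (E j))).
Proof.
move=> bf skew phiF.
transitivity (\sum_j \sum_m qform (phi (F j)) (E m) *: f (F m) (E j)).
  by apply: eq_bigr => j _; rewrite -[in LHS]phiF /lproj (bilinear_suml bf).
rewrite exchange_big -sumrN; apply: eq_bigr => m _ /=.
rewrite /lproj (bilinear_sumr bf) -sumrN; apply: eq_bigr => j _.
by rewrite skew scaleNr form_sym.
Qed.

End QuadraticLieAlgebras.

Section Contractions.
Variables (C : fieldType) (g : quadraticLie C) (d : nat) (E F : 'I_d -> g) (u : g).
Local Notation al := (lproj E F).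
Local Notation ab := (lproj F E).
Hypothesis EF_dual : forall j m, qform (E j) (F m) = (j == m)%:R.
Hypothesis E_isotropic : forall j m, qform (E j) (E m) = 0.
Hypothesis F_isotropic : forall j m, qform (F j) (F m) = 0.
Hypothesis EE_closed : forall j m, al (qlie (E j) (E m)) = qlie (E j) (E m).
Hypothesis FF_closed : forall j m, ab (qlie (F j) (F m)) = qlie (F j) (F m).
Hypothesis uE_closed : forall j, al (qlie u (E j)) = qlie u (E j).
Hypothesis uF_closed : forall j, ab (qlie u (F j)) = qlie u (F j).
Hypothesis sum_EF : \sum_j qlie (E j) (F j) = - (2 *: u).

(* Locked, lest [lsign x] be unfolded when unified with a difference. *)
Definition lsign (x : g) := locked (lproj E F x - lproj F E x).
Local Notation sg := lsign.

Lemma lsign_def x : sg x = lproj E F x - lproj F E x.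
Proof. by rewrite /lsign -lock. Qed.

Lemma lsign_linear : linear sg.
Proof. by move=> k x y; rewrite !lsign_def !linearP /=; lmod C; ring. Qed.

HB.instance Definition _ := GRing.isLinear.Build C g g *:%R lsign lsign_linear.

Lemma lsignD x y : sg (x + y) = sg x + sg y. Proof. exact: linearD. Qed.
Lemma lsignN x : sg (- x) = - sg x. Proof. exact: linearN. Qed.
Lemma lsignZ k x : sg (k *: x) = k *: sg x. Proof. exact: linearZ. Qed.

Definition ldefect (a b : g) := sg (qlie a b) - qlie (sg a) b - qlie a (sg b).
Local Notation nu := ldefect.

Let alE j : al (E j) = E j.
Proof.
rewrite /lproj (bigD1 j) //= EF_dual eqxx scale1r big1 ?addr0 // => m mj.
by rewrite EF_dual eq_sym (negPf mj) scale0r.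
Qed.

Let abF j : ab (F j) = F j.
Proof.
rewrite /lproj (bigD1 j) //= form_sym EF_dual eqxx scale1r big1 ?addr0 // => m mj.
by rewrite form_sym EF_dual (negPf mj) scale0r.
Qed.

Let abE j : ab (E j) = 0.
Proof. by rewrite /lproj big1 // => m _; rewrite E_isotropic scale0r. Qed.

Let alF j : al (F j) = 0.
Proof. by rewrite /lproj big1 // => m _; rewrite F_isotropic scale0r. Qed.

Let ab_al x : ab (al x) = 0.
Proof. by rewrite {2}/lproj linear_sum big1 // => j _; rewrite linearZ /= abE scaler0. Qed.

Let al_ab x : al (ab x) = 0.
Proof. by rewrite {2}/lproj linear_sum big1 // => j _; rewrite linearZ /= alF scaler0. Qed.

Lemma lsignl x : al x = x -> sg x = x.
Proof. by move=> alx; rewrite !lsign_def -[in ab x]alx ab_al subr0. Qed.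

Lemma lsignr x : ab x = x -> sg x = - x.
Proof. by move=> abx; rewrite !lsign_def -[in al x]abx al_ab abx sub0r. Qed.

Lemma lsignE j : sg (E j) = E j. Proof. exact: lsignl (alE j). Qed.
Lemma lsignF j : sg (F j) = - F j. Proof. exact: lsignr (abF j). Qed.

Lemma lsign_skew x y : qform (sg x) y = - qform x (sg y).
Proof.
have proj x' y' : qform (al x') y' = qform x' (ab y').
  rewrite /lproj qform_suml qform_sumr; apply: eq_bigr => j _.
  by rewrite qformZl qformZr mulrC form_sym.
have proj' x' y' : qform (ab x') y' = qform x' (al y').
  by rewrite form_sym -proj form_sym.
by rewrite !lsign_def -!scaleN1r !qformDl !qformDr !qformZl !qformZr proj proj'; ring.
Qed.

(** ad F_n preserves lbar but in general not l, so only the component in l of [F_n, E_m] is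
    accessible. *)
Let contractF (W : lmodType C) (f : g -> g -> W) n : bilinear_map f ->
  \sum_m f (F m) (al (qlie (F n) (E m))) = - \sum_m f (qlie (F n) (F m)) (E m).
Proof.
move=> bf; rewrite (skew_contract (phi := qlie (F n)) bf) ?opprK // => x y.
exact: qform_ad.
Qed.

Let contractE (W : lmodType C) (f : g -> g -> W) n : bilinear_map f ->
  \sum_m f (E m) (ab (qlie (E n) (F m))) = - \sum_m f (qlie (E n) (E m)) (F m).
Proof.
move=> bf; rewrite (skew_contract (phi := qlie (E n)) bf) ?opprK // => x y.
exact: qform_ad.
Qed.

Lemma ldefectC x y : nu x y = - nu y x.
Proof.
by rewrite /nu (lieC x) (lieC (sg x)) (lieC x (sg y)) lsignN; lmod C; ring.
Qed.

(** Invariance of the tensor Σ_j e_j ⊗ f_j under ad u, stated through all bilinear maps in place of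
    a tensor product. *)
Definition ad_invariant (e f : 'I_d -> g) := forall (W : lmodType C) (h : g -> g -> W),
  bilinear_map h -> \sum_j h (qlie u (e j)) (f j) + \sum_j h (e j) (qlie u (f j)) = 0.

Lemma ad_invariantFE : ad_invariant F E.
Proof.
move=> W h bh; rewrite (skew_contract (phi := qlie u) bh) ?uF_closed //; last first.
  by move=> x y; exact: qform_ad.
by under eq_bigr => j _ do rewrite uE_closed; rewrite addNr.
Qed.

Lemma ad_invariantEF : ad_invariant E F.
Proof. by move=> W h /bilinear_flip /ad_invariantFE; rewrite addrC. Qed.

(** * Contractions with an alternating bilinear map *)

Section Alternating.
Variables (W : lmodType C) (B : g -> g -> W).
Hypotheses (B_bilinear : bilinear_map B) (B_alt : forall x y, B x y = - B y x).

Let BDl := bilinear_Dl B_bilinear.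
Let BZl := bilinear_Zl B_bilinear.
Let BDr := bilinear_Dr B_bilinear.
Let BZr := bilinear_Zr B_bilinear.
Let B0l := bilinear_0l B_bilinear.

Let BNl x z : B (- x) z = - B x z.
Proof. by rewrite -[- x]scaleN1r BZl scaleN1r. Qed.

Let BNr x z : B z (- x) = - B z x.
Proof. by rewrite -[- x]scaleN1r BZr scaleN1r. Qed.

Let B_suml (I : Type) (r : seq I) (P : pred I) (f : I -> g) y :
  B (\sum_(i <- r | P i) f i) y = \sum_(i <- r | P i) B (f i) y.
Proof. by apply: (big_morph (B ^~ y)) => [a b|]; rewrite ?BDl ?B0l. Qed.

Let B_sumr (I : Type) (r : seq I) (P : pred I) (f : I -> g) y :
  B y (\sum_(i <- r | P i) f i) = \sum_(i <- r | P i) B y (f i).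
Proof. by rewrite B_alt B_suml -sumrN; apply: eq_bigr => i _; rewrite -B_alt. Qed.

Let linE := (lieDl, lieZl, lieDr, lieZr, BDl, BZl, BDr, BZr).

(** The vectors y_k and z_k are built from the controlled brackets [F_j, F_k] and [E_j, E_k]. The
    sums [YE], [FZ], [sYE], [FsZ] and [G] are the normal forms of all contractions below. *)
Let y_ k := \sum_j qlie (E j) (qlie (F j) (F k)).
Let z_ k := \sum_j qlie (F j) (qlie (E j) (E k)).
Let YE := \sum_k B (y_ k) (E k).
Let FZ := \sum_k B (F k) (z_ k).
Let sYE := \sum_k B (sg (y_ k)) (E k).
Let FsZ := \sum_k B (F k) (sg (z_ k)).
Let G := \sum_j \sum_k B (qlie (F j) (F k)) (qlie (E j) (E k)).

(** The value of a second-order operator on a product of three factors of which each is killed: the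
    sum over pairs of the defect of the pair times the third factor. *)
Definition second_order (x y z : g) := B (nu x y) z + B (nu y z) x + B (nu z x) y.

Let lie_bilinear : bilinear_map (@qlie C g).
Proof. by split=> *; [apply: lie_linearl | apply: lie_linearr]. Qed.

Let sum_ad_al j : \sum_k qlie (F k) (al (qlie (F j) (E k))) = - y_ j.
Proof.
rewrite (contractF _ lie_bilinear); congr (- _).
by apply: eq_bigr => k _; apply: lie_flip.
Qed.

Let sum_ad_ab k : \sum_j qlie (ab (qlie (F j) (E k))) (E j) = - z_ k.
Proof.
under eq_bigr => j _ do rewrite (lieC (F j)) linearN lieNl lieC opprK.
rewrite (contractE _ lie_bilinear); congr (- _).
by apply: eq_bigr => j _; apply: lie_flip.
Qed.

(** Compared with [sum_ad_al], the projection to l is dropped; Jacobi and [sum_EF] show that this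
    costs a multiple of [u, F_j]. *)
Let sum_ad j : \sum_k qlie (F k) (qlie (F j) (E k)) = - y_ j - 2 *: qlie u (F j).
Proof.
under eq_bigr => k _ do rewrite lie_jacobi (lieC (F k) (E k)) linearN lie_flip.
have E_ : \sum_k qlie (F j) (qlie (E k) (F k)) = 2 *: qlie u (F j).
  by rewrite -linear_sum sum_EF /= linearN linearZ /= (lieC (F j)); lmod C; ring.
rewrite sumrB {}E_.
suff -> : \sum_k qlie (E k) (qlie (F j) (F k)) = - y_ j by lmod C; ring.
by rewrite /y_ -sumrN; apply: eq_bigr => k _; rewrite (lieC (F j)) linearN.
Qed.

Let sum_ad' k : \sum_j qlie (qlie (F j) (E k)) (E j) = - z_ k + 2 *: qlie u (E k).
Proof.
under eq_bigr => j _ do rewrite lieC lie_jacobi.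
rewrite sumrN big_split /= -lie_suml sum_EF -/(z_ k).
by rewrite -scaleNr lieZl; lmod C; ring.
Qed.

Let nuEE j k : nu (E j) (E k) = - qlie (E j) (E k).
Proof. by rewrite /nu (lsignl (EE_closed j k)) !(lsignl (alE _)); lmod C; ring. Qed.

Let nuFF j k : nu (F j) (F k) = qlie (F j) (F k).
Proof.
rewrite /nu (lsignr (FF_closed j k)) !(lsignr (abF _)) linearN /= lieNl.
by lmod C; ring.
Qed.

Let nuEF j k : nu (E j) (F k) = sg (qlie (E j) (F k)).
Proof. by rewrite /nu (lsignl (alE j)) (lsignr (abF k)) linearN /=; lmod C; ring. Qed.

Let nuF j x : nu (F j) x =
  sg (qlie (F j) x) + qlie (F j) x - qlie (F j) (al x) + qlie (F j) (ab x).
Proof.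
rewrite /nu (lsignr (abF j)) lieNl !lsign_def linearB /=.
by lmod C; ring.
Qed.

Let nuE x j : nu x (E j) =
  sg (qlie x (E j)) - qlie x (E j) - qlie (al x) (E j) + qlie (ab x) (E j).
Proof.
rewrite /nu (lsignl (alE j)) !lsign_def lieDl lieNl.
by lmod C; ring.
Qed.

Let sum_al_EF :
  \sum_j \sum_k B (al (qlie (E j) (F k))) (qlie (F j) (E k)) = YE.
Proof.
rewrite exchange_big /=.
transitivity (\sum_k \sum_j - B (al (qlie (F k) (E j))) (qlie (F j) (E k))).
  by apply: eq_bigr => k _; apply: eq_bigr => j _; rewrite (lieC (E j)) linearN /= BNl.
transitivity (\sum_k \sum_j B (E j) (qlie (qlie (F k) (F j)) (E k))).
  apply: eq_bigr => k _; rewrite sumrN.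
  rewrite (contractF (f := fun x y => B y (qlie x (E k)))) ?opprK //.
  by split=> ? c a b /=; rewrite !linE.
rewrite exchange_big; apply: eq_bigr => j _; rewrite /y_ B_suml.
by apply: eq_bigr => k _; rewrite B_alt lie_flip (lieC (F j)) linearN BNl opprK.
Qed.

Let sum_ab_EF :
  \sum_j \sum_k B (ab (qlie (E j) (F k))) (qlie (F j) (E k)) = - FZ.
Proof.
rewrite /FZ -sumrN.
transitivity (\sum_j \sum_k - B (F k) (qlie (F j) (qlie (E j) (E k)))).
  apply: eq_bigr => j _; rewrite sumrN.
  rewrite (contractE (f := fun x y => B y (qlie (F j) x))); last first.
    by split=> ? c a b /=; rewrite !linE.
  by [].
rewrite exchange_big; apply: eq_bigr => k _.
by rewrite /z_ B_sumr sumrN.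
Qed.

Let sum_B_ad_ab :
  \sum_j \sum_k B (qlie (F k) (ab (qlie (F j) (E k)))) (E j) = G.
Proof.
rewrite exchange_big; apply: eq_bigr => k _ /=.
transitivity (- \sum_j B (qlie (F k) (ab (qlie (E k) (F j)))) (E j)).
  rewrite -sumrN; apply: eq_bigr => j _.
  by rewrite (lieC (F j)) !linearN BNl.
rewrite (contractE (f := fun x y => B (qlie (F k) y) x)) ?opprK.
  apply: eq_bigr => j _.
  by [].
by split=> ? c a b /=; rewrite !linE.
Qed.

Let sum_B_ad_al :
  \sum_j \sum_k B (qlie (al (qlie (F j) (E k))) (E j)) (F k) = - G.
Proof.
rewrite /G -sumrN; apply: eq_bigr => j _.
rewrite (contractF (f := fun x y => B (qlie y (E j)) x)).
  congr (- _); apply: eq_bigr => k _.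
  by rewrite B_alt (lieC (E k)) BNr opprK.
by split=> ? c a b /=; rewrite !linE.
Qed.

Let sum_delta_EF :
  \sum_j \sum_k second_order (E j) (F k) (qlie (F j) (E k)) = YE + FZ - sYE + FsZ + 2 *: G.
Proof.
rewrite /second_order; under eq_bigr => j _ do rewrite !big_split /=.
rewrite !big_split /=.
have -> : \sum_j \sum_k B (nu (E j) (F k)) (qlie (F j) (E k)) = YE + FZ.
  under eq_bigr => j _ do under eq_bigr => k _ do rewrite nuEF lsign_def BDl BNl.
  under eq_bigr => j _ do rewrite sumrB.
  by rewrite sumrB sum_al_EF sum_ab_EF opprK.
have -> : \sum_j \sum_k B (nu (F k) (qlie (F j) (E k))) (E j) = - sYE + G.
  (* Only the term of [nuF] with the projection to lbar is left out. Summed over k, this gives - σ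
     y_j alone: the rest is - 2 σ[u, F_j] - 2 [u, F_j], and σ is -1 on [u, F_j]. *)
  pose s j k := sg (qlie (F k) (qlie (F j) (E k))) + qlie (F k) (qlie (F j) (E k))
    - qlie (F k) (al (qlie (F j) (E k))).
  transitivity (\sum_j \sum_k (B (s j k) (E j)
     + B (qlie (F k) (ab (qlie (F j) (E k)))) (E j))).
    do 2!(apply: eq_bigr => ? _); rewrite nuF /s !BDl !BNl; lmod C; ring.
  under eq_bigr => j _ do rewrite big_split /=.
  rewrite big_split /= sum_B_ad_ab; congr (_ + _); rewrite /sYE -sumrN.
  apply: eq_bigr => j _; rewrite -B_suml /s sumrB big_split /= -linear_sum.
  rewrite sum_ad sum_ad_al -BNl; congr (B _ _).
  by rewrite /= !lsignD !lsignN lsignZ (lsignr (uF_closed j)); lmod C; ring.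
have -> : \sum_j \sum_k B (nu (qlie (F j) (E k)) (E j)) (F k) = FsZ + G.
  pose s j k := sg (qlie (qlie (F j) (E k)) (E j)) - qlie (qlie (F j) (E k)) (E j)
    + qlie (ab (qlie (F j) (E k))) (E j).
  transitivity (\sum_j \sum_k (B (s j k) (F k)
     - B (qlie (al (qlie (F j) (E k))) (E j)) (F k))).
    do 2!(apply: eq_bigr => ? _); rewrite nuE /s !BDl !BNl; lmod C; ring.
  under eq_bigr => j _ do rewrite sumrB.
  rewrite sumrB sum_B_ad_al opprK exchange_big /=; congr (_ + _).
  apply: eq_bigr => k _; rewrite -B_suml /s big_split sumrB /= -linear_sum.
  rewrite sum_ad' sum_ad_ab B_alt -BNr; congr (B _ _).
  by rewrite /= lsignD lsignZ lsignN (lsignl (uE_closed k)); lmod C; ring.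
by lmod C; ring.
Qed.

(** [second_order] is antisymmetric in its first two arguments and [E_j, F_k] = - [F_k, E_j], so
    exchanging j and k reduces this to [sum_delta_EF]. *)
Let sum_delta_FE :
  \sum_j \sum_k second_order (F j) (E k) (qlie (E j) (F k)) = YE + FZ - sYE + FsZ + 2 *: G.
Proof.
rewrite -sum_delta_EF exchange_big; apply: eq_bigr => k _; apply: eq_bigr => j _.
have nuN x y : nu x (- y) = - nu x y.
  by rewrite /nu !lsignN !(linearN (qlie _)) /= lsignN; lmod C; ring.
rewrite /second_order (lieC (E j)); set q := qlie (F k) (E j).
rewrite (ldefectC (- q)) !nuN (ldefectC (F j) (E k)) (ldefectC q) !opprK !BNl !BNr.
by lmod C; ring.
Qed.

Let sum_delta_EE :
  \sum_j \sum_k second_order (E j) (E k) (qlie (F j) (F k)) = G - 2 *: sYE.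
Proof.
have nuEab j x : ab x = x -> nu (E j) x = sg (qlie (E j) x).
  by move=> abx; rewrite /nu (lsignl (alE j)) (lsignr abx) linearN /=; lmod C; ring.
have nuabE j x : ab x = x -> nu x (E j) = sg (qlie x (E j)).
  by move=> abx; rewrite /nu (lsignl (alE j)) (lsignr abx) lieNl; lmod C; ring.
rewrite /second_order; under eq_bigr => j _ do rewrite !big_split /=.
rewrite !big_split /=.
have -> : \sum_j \sum_k B (nu (E j) (E k)) (qlie (F j) (F k)) = G.
  by do 2!(apply: eq_bigr => ? _); rewrite nuEE B_alt BNr opprK.
have E1 : \sum_j \sum_k B (nu (E k) (qlie (F j) (F k))) (E j) = - sYE.
  rewrite -sumrN; apply: eq_bigr => j _; rewrite -B_suml -BNl; congr (B _ _).
  under eq_bigr => k _ do rewrite nuEab ?FF_closed // (lieC (F j)) linearN lsignN.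
  by rewrite sumrN -linear_sum.
have -> : \sum_j \sum_k B (nu (qlie (F j) (F k)) (E j)) (E k) = - sYE.
  rewrite -E1 exchange_big; do 2!(apply: eq_bigr => ? _).
  by rewrite nuabE ?FF_closed // nuEab ?FF_closed // lie_flip.
by rewrite E1; lmod C; ring.
Qed.

Let sum_delta_FF :
  \sum_j \sum_k second_order (F j) (F k) (qlie (E j) (E k)) = G + 2 *: FsZ.
Proof.
have nuFal j x : al x = x -> nu (F j) x = sg (qlie (F j) x).
  by move=> alx; rewrite /nu (lsignl alx) (lsignr (abF j)) lieNl; lmod C; ring.
have nualF j x : al x = x -> nu x (F j) = sg (qlie x (F j)).
  by move=> alx; rewrite /nu (lsignl alx) (lsignr (abF j)) linearN /=; lmod C; ring.
rewrite /second_order; under eq_bigr => j _ do rewrite !big_split /=.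
rewrite !big_split /=.
have -> : \sum_j \sum_k B (nu (F j) (F k)) (qlie (E j) (E k)) = G.
  by do 2!(apply: eq_bigr => ? _); rewrite nuFF.
have E1 : \sum_j \sum_k B (nu (F k) (qlie (E j) (E k))) (F j) = FsZ.
  apply: eq_bigr => j _; rewrite -B_suml B_alt -BNr; congr (B _ _).
  under eq_bigr => k _ do rewrite nuFal ?EE_closed // (lieC (E j)) linearN lsignN.
  by rewrite sumrN -linear_sum opprK.
have -> : \sum_j \sum_k B (nu (qlie (E j) (E k)) (F j)) (F k) = FsZ.
  rewrite -E1 exchange_big; do 2!(apply: eq_bigr => ? _).
  by rewrite nualF ?EE_closed // nuFal ?EE_closed // lie_flip.
by rewrite E1; lmod C; ring.
Qed.

(** ad b ad a applied by the Leibniz rule to Σ_m F_m ⊗ E_m. *)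
Definition ad_sum (b a : g) := \sum_m
  (B (qlie b (qlie a (F m))) (E m) + B (qlie a (F m)) (qlie b (E m))
   + (B (qlie b (F m)) (qlie a (E m)) + B (F m) (qlie b (qlie a (E m))))).

(** Both sides equal 2 ([YE] + [FZ] + [G]). On the left the sums with σ cancel; on the right the
    terms in u created by exchanging ad E_j and ad F_j add up to -4 times the sum in u. *)
Lemma sum_delta_cubic : (2 : C) != 0 ->
  \sum_j \sum_k (second_order (E j) (F k) (qlie (F j) (E k))
                 + second_order (F j) (E k) (qlie (E j) (F k))
                 - second_order (E j) (E k) (qlie (F j) (F k))
                 - second_order (F j) (F k) (qlie (E j) (E k)))
  = 4 *: (\sum_j B (F j) (qlie u (E j))) + \sum_j (ad_sum (F j) (E j) + ad_sum (E j) (F j)).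
Proof.
move=> two_neq0.
transitivity (2 *: (YE + FZ + G)).
  under eq_bigr => j _ do rewrite !sumrB big_split /=.
  rewrite !sumrB big_split /= sum_delta_EF sum_delta_FE sum_delta_EE sum_delta_FF.
  by lmod C; ring.
(* Exchanging j and m changes the sign, as B is alternating; hence twice the sum is 0. *)
have sum0 : \sum_j \sum_m B (qlie (E j) (F m)) (qlie (F j) (E m)) = 0.
  set S := \sum_j _; have : 2 *: S = 0.
    rewrite scaler_nat mulr2n -[X in _ + X]opprK; apply/eqP; rewrite subr_eq0; apply/eqP.
    rewrite [in RHS]/S exchange_big -sumrN; apply: eq_bigr => j _; rewrite -sumrN.
    by apply: eq_bigr => m _; rewrite B_alt (lieC (F j)) (lieC (E j)) BNl BNr opprK.
  by move/eqP; rewrite scaler_eq0 (negPf two_neq0) => /eqP.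
have sum1 : \sum_j \sum_m B (qlie (F j) (qlie (E j) (F m))) (E m)
    = 2 *: (\sum_m B (qlie u (F m)) (E m)) + YE.
  rewrite exchange_big scaler_sumr -big_split; apply: eq_bigr => m _ /=.
  rewrite -B_suml -BZl -BDl; congr (B _ _).
  under eq_bigr => j _ do rewrite lie_jacobi (lieC (F j)).
  by rewrite big_split -lie_suml sumrN sum_EF opprK lieZl.
have sum4 : \sum_j \sum_m B (F m) (qlie (E j) (qlie (F j) (E m)))
    = FZ - 2 *: (\sum_m B (F m) (qlie u (E m))).
  rewrite exchange_big scaler_sumr -sumrB; apply: eq_bigr => m _ /=.
  rewrite -B_sumr -BZr -BNr -BDr; congr (B _ _).
  under eq_bigr => j _ do rewrite lie_jacobi.
  by rewrite big_split -lie_suml sum_EF lieNl lieZl addrC.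
have sum1' : \sum_j \sum_m B (qlie (E j) (qlie (F j) (F m))) (E m) = YE.
  by rewrite exchange_big; apply: eq_bigr => m _; rewrite -B_suml.
have sum4' : \sum_j \sum_m B (F m) (qlie (F j) (qlie (E j) (E m))) = FZ.
  by rewrite exchange_big; apply: eq_bigr => m _; rewrite -B_sumr.
have := ad_invariantFE B_bilinear => /eqP; rewrite addr_eq0 => /eqP uFE.
rewrite /ad_sum big_split /=.
under [X in _ + (X + _)]eq_bigr => j _ do rewrite !big_split /=.
under [X in _ + (_ + X)]eq_bigr => j _ do rewrite !big_split /=.
rewrite !big_split /= sum1 sum4 sum1' sum4' sum0 -/G uFE.
by set S := \sum_m B (F m) (qlie u (E m)); lmod C; ring.
Qed.

End Alternating.

(** * Derivations acting on an alternating cubic expression *)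

Section Trilinear.
Variables (W : lmodType C) (T : g -> g -> g -> W).
Hypothesis T_linear : forall y z, linear (fun x => T x y z).
Hypotheses (T12 : forall x y z, T x y z = - T y x z)
           (T23 : forall x y z, T x y z = - T x z y).

Let TDl x x' y z : T (x + x') y z = T x y z + T x' y z.
Proof. by have := T_linear y z 1 x x'; rewrite !scale1r. Qed.

Let T0l y z : T 0 y z = 0.
Proof. by apply: (addrI (T 0 y z)); rewrite -TDl !addr0. Qed.

Let TZl k x y z : T (k *: x) y z = k *: T x y z.
Proof. by have := T_linear y z k x 0; rewrite /= addr0 T0l addr0. Qed.

Let TDm x x' y z : T y (x + x') z = T y x z + T y x' z.
Proof. by rewrite T12 TDl opprD -!(T12 y). Qed.

Let TZm k x y z : T y (k *: x) z = k *: T y x z.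
Proof. by rewrite T12 TZl -scalerN -(T12 y). Qed.

Let TDr x x' y z : T y z (x + x') = T y z x + T y z x'.
Proof. by rewrite T23 TDm opprD -!(T23 y). Qed.

Let TZr k x y z : T y z (k *: x) = k *: T y z x.
Proof. by rewrite T23 TZm -scalerN -(T23 y). Qed.

Let TNr x y z : T y z (- x) = - T y z x.
Proof. by rewrite -[- x]scaleN1r TZr scaleN1r. Qed.

Let linE := (lieDl, lieZl, lieDr, lieZr, TDl, TZl, TDm, TZm, TDr, TZr).

Definition derT (phi : g -> g) x y z := T (phi x) y z + T x (phi y) z + T x y (phi z).

Definition der_cubic (phi : g -> g) := \sum_j \sum_k
  (derT phi (E j) (F k) (qlie (F j) (E k)) + derT phi (F j) (E k) (qlie (E j) (F k))
   - derT phi (E j) (E k) (qlie (F j) (F k)) - derT phi (F j) (F k) (qlie (E j) (E k))).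

(** ad u is a derivation of the bracket in the third argument, so the sum splits into one invariance
    relation for each index. *)
Let der_u_pair e f e' f' : ad_invariant e f -> ad_invariant e' f' ->
  \sum_j \sum_k derT (qlie u) (e j) (e' k) (qlie (f j) (f' k)) = 0.
Proof.
move=> ef e'f'.
transitivity (\sum_k (\sum_j T (qlie u (e j)) (e' k) (qlie (f j) (f' k))
                      + \sum_j T (e j) (e' k) (qlie (qlie u (f j)) (f' k)))
  + \sum_j (\sum_k T (e j) (qlie u (e' k)) (qlie (f j) (f' k))
            + \sum_k T (e j) (e' k) (qlie (f j) (qlie u (f' k))))).
  rewrite [X in X + _]big_split [X in _ + X]big_split /=.
  rewrite [X in (X + _) + _]exchange_big [X in (_ + X) + _]exchange_big.
  rewrite -!big_split; apply: eq_bigr => j _; rewrite -!big_split /=.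
  apply: eq_bigr => k _; rewrite /derT lie_jacobi TDr; lmod C; ring.
rewrite big1 => [|k _]; last first.
  by apply: (ef _ (fun x y => T x (e' k) (qlie y (f' k)))); split=> ? c a b /=; rewrite !linE.
rewrite big1 ?addr0 // => j _.
by apply: (e'f' _ (fun x y => T (e j) x (qlie (f j) y))); split=> ? c a b /=; rewrite !linE.
Qed.

Lemma der_cubic_ad : der_cubic (qlie u) = 0.
Proof.
rewrite /der_cubic; under eq_bigr => j _ do rewrite !sumrB big_split /=.
rewrite !sumrB big_split /= !der_u_pair ?subr0 ?addr0 //.
all: by [exact: ad_invariantFE | exact: ad_invariantEF].
Qed.

(** On the mixed terms the eigenvalues of σ on E_j and F_k cancel, leaving σ of the bracket, which
    contracts to unmixed sums; on the unmixed terms σ has eigenvalue 1 or -1 in total. The right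
    side has the shape of Σ_j (E_j X(F_j) + F_j X(E_j)), where X(a) is ad a applied to Σ_m F_m ⊗
    E_m. *)
Lemma der_cubic_lsign :
  der_cubic sg = - \sum_j \sum_k
    (T (E j) (qlie (F j) (F k)) (E k) + T (E j) (F k) (qlie (F j) (E k))
     + (T (F j) (qlie (E j) (F k)) (E k) + T (F j) (F k) (qlie (E j) (E k)))).
Proof.
pose TEE := \sum_j \sum_k T (E j) (E k) (qlie (F j) (F k)).
pose TFF := \sum_j \sum_k T (F j) (F k) (qlie (E j) (E k)).
have TEFal : \sum_j \sum_k T (E j) (F k) (al (qlie (F j) (E k))) = TEE.
  apply: eq_bigr => j _; rewrite (contractF (f := fun x y => T (E j) x y)).
    by rewrite -sumrN; apply: eq_bigr => k _; rewrite -T23.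
  by split=> ? c a b /=; rewrite !linE.
have TEFab : \sum_j \sum_k T (E j) (F k) (ab (qlie (F j) (E k))) = TFF.
  rewrite exchange_big; apply: eq_bigr => k _ /=.
  transitivity (- \sum_j T (E j) (F k) (ab (qlie (E k) (F j)))).
    by rewrite -sumrN; apply: eq_bigr => j _; rewrite (lieC (F j)) linearN TNr.
  rewrite (contractE (f := fun x y => T x (F k) y)) ?opprK.
    by apply: eq_bigr => j _; rewrite T12 T23 opprK.
  by split=> ? c a b /=; rewrite !linE.
have TEF_FE (phi : g -> g) : (forall x, phi (- x) = - phi x) ->
    \sum_j \sum_k T (F j) (E k) (phi (qlie (E j) (F k)))
    = \sum_j \sum_k T (E j) (F k) (phi (qlie (F j) (E k))).
  move=> phiN; rewrite exchange_big; apply: eq_bigr => j _; apply: eq_bigr => k _.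
  by rewrite T12 (lieC (E k)) phiN TNr opprK.
transitivity (TEE - TFF).
  transitivity (\sum_j \sum_k (T (E j) (F k) (sg (qlie (F j) (E k)))
      + T (F j) (E k) (sg (qlie (E j) (F k))) - T (E j) (E k) (qlie (F j) (F k))
      + T (F j) (F k) (qlie (E j) (E k)))).
    rewrite /der_cubic; do 2!(apply: eq_bigr => ? _).
    rewrite /derT !(lsignl (alE _)) !(lsignr (abF _)).
    rewrite (lsignl (EE_closed _ _)) (lsignr (FF_closed _ _)).
    by rewrite -!scaleN1r !TZl !TZm !TZr; lmod C; ring.
  under eq_bigr => j _ do rewrite big_split sumrB big_split /=.
  rewrite big_split sumrB big_split /= TEF_FE; last exact: lsignN.
  have -> : \sum_j \sum_k T (E j) (F k) (sg (qlie (F j) (E k))) = TEE - TFF.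
    rewrite -TEFal -TEFab -sumrB; apply: eq_bigr => j _; rewrite -sumrB.
    by apply: eq_bigr => k _; rewrite !lsign_def TDr TNr.
  by rewrite -/TEE -/TFF; lmod C; ring.
under [X in _ = - X]eq_bigr => j _ do rewrite !big_split /=.
rewrite !big_split /= -/TFF.
have -> : \sum_j \sum_k T (E j) (qlie (F j) (F k)) (E k) = - TEE.
  by rewrite -sumrN; apply: eq_bigr => j _; rewrite -sumrN; apply: eq_bigr => k _; rewrite T23.
have -> : \sum_j \sum_k T (F j) (qlie (E j) (F k)) (E k)
    = - \sum_j \sum_k T (E j) (F k) (qlie (F j) (E k)).
  rewrite -(TEF_FE id) // -sumrN; apply: eq_bigr => j _; rewrite -sumrN.
  by apply: eq_bigr => k _; rewrite T23.
by set S := \sum_j \sum_k T (E j) (F k) _; lmod C; ring.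
Qed.

Lemma der_cubicD (phi psi : g -> g) k m :
  der_cubic (fun x => k *: phi x + m *: psi x) = k *: der_cubic phi + m *: der_cubic psi.
Proof.
rewrite /der_cubic !scaler_sumr -big_split; apply: eq_bigr => j _ /=.
rewrite !scaler_sumr -big_split; apply: eq_bigr => p _ /=.
by rewrite /derT !(TDl, TZl, TDm, TZm, TDr, TZr); lmod C; ring.
Qed.

End Trilinear.
End Contractions.

(** * The superaffine vertex algebra *)

Section Superaffine.
Variables (C : fieldType) (C_char0 : [pchar C] =i pred0).
Variables (i k : C) (i2 : i ^+ 2 = -1) (k_neq0 : k != 0).
Variables (g : quadraticLie C) (V : susyVA C) (Pi : {linear g -> V}).
Hypothesis Pi_odd : forall a, homog true (Pi a).
Hypothesis br_Pi : forall a b n j, br (Pi a) (Pi b) (n, j) =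
  if n is 0 then if j then (k * qform a b) *: vac V else Pi (qlie a b) else 0.
Variables (d : nat) (E F : 'I_d -> g) (u : g).
Hypothesis EF_dual : forall j m, qform (E j) (F m) = (j == m)%:R.
Hypothesis E_isotropic : forall j m, qform (E j) (E m) = 0.
Hypothesis F_isotropic : forall j m, qform (F j) (F m) = 0.
Hypothesis EE_closed : forall j m, lproj E F (qlie (E j) (E m)) = qlie (E j) (E m).
Hypothesis FF_closed : forall j m, lproj F E (qlie (F j) (F m)) = qlie (F j) (F m).
Hypothesis uE_closed : forall j, lproj E F (qlie u (E j)) = qlie u (E j).
Hypothesis uF_closed : forall j, lproj F E (qlie u (F j)) = qlie u (F j).
Hypothesis sum_EF : \sum_j qlie (E j) (F j) = - (2 *: u).

Local Notation sg := (lsign E F).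
Local Notation nu := (ldefect E F).
Local Notation B x y := (nop (Pi x) (Pi y)).
Local Notation T x y z := (nop (Pi x) (nop (Pi y) (Pi z))).
Local Notation Bf := (fun x y => nop (Pi x) (Pi y)).
Local Notation Tf := (fun x y z => nop (Pi x) (nop (Pi y) (Pi z))).
Local Notation low := [:: (0%N, false); (0%N, true); (1%N, false)].
Local Notation SD := (SD V).

Let natC_neq0 n : n.+1%:R != 0 :> C.
Proof. by rewrite (pcharf0P C).1. Qed.

Let SDN x : SD (- x) = - SD x. Proof. exact: linearN. Qed.
Let SDD x y : SD (x + y) = SD x + SD y. Proof. exact: linearD. Qed.
Let SDZ c x : SD (c *: x) = c *: SD x. Proof. exact: linearZ. Qed.
Let SD0 : SD 0 = 0. Proof. exact: linear0. Qed.
Let PiN x : Pi (- x) = - Pi x. Proof. exact: linearN. Qed.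
Let PiD x y : Pi (x + y) = Pi x + Pi y. Proof. exact: linearD. Qed.
Let PiZ c x : Pi (c *: x) = c *: Pi x. Proof. exact: linearZ. Qed.
Let Pi_sum (f : 'I_d -> g) : Pi (\sum_m f m) = \sum_m Pi (f m).
Proof. exact: linear_sum. Qed.
Let SD_sum (f : 'I_d -> V) : SD (\sum_m f m) = \sum_m SD (f m).
Proof. exact: linear_sum. Qed.
Let nop_sumr a (f : 'I_d -> V) : nop a (\sum_m f m) = \sum_m nop a (f m).
Proof. exact: linear_sum. Qed.
Let nopDr a b c : nop c (a + b) = nop c a + nop c b :> V.
Proof. exact: linearD. Qed.
Let nopNr a c : nop c (- a) = - nop c a :> V.
Proof. exact: linearN. Qed.
Let nopZr (x : C) a c : nop c (x *: a) = x *: nop c a :> V.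
Proof. exact: linearZ. Qed.

Let linE := (nopDl, nopZl, nopNl, nopDr, nopZr, nopNr, SDD, SDZ, SDN, PiD, PiZ, PiN).

Let B_bilinear : bilinear_map Bf.
Proof. by split=> ? c a b /=; rewrite PiD PiZ ?nopDl ?nopZl ?nopDr ?nopZr. Qed.

(** The quasicommutator is T of a multiple of the vacuum, hence 0: generators anticommute
    exactly. *)
Let B_alt x y : B x y = - B y x.
Proof.
rewrite (quasicomm_low (Pi_odd x) (Pi_odd y)) => [|n]; last by rewrite br_Pi.
by rewrite br_Pi /TD !SDZ SD_vac linear0 scaler0 addr0 scaleN1r.
Qed.

Let T_linear y z : linear (fun x => T x y z).
Proof. by move=> c a b /=; rewrite PiD PiZ nopDl nopZl. Qed.

Let T23 x y z : T x y z = - T x z y.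
Proof. by rewrite -nopNr; congr nop; exact: B_alt. Qed.

(* Both sides of quasiassociativity are antisymmetric in the first two odd
   arguments. *)
Let T12 x y z : T x y z = - T y x z.
Proof.
have Exy := nop_quasiassoc (Pi z) (Pi_odd x) (Pi_odd y).
have Eyx := nop_quasiassoc (Pi z) (Pi_odd y) (Pi_odd x).
apply/eqP; rewrite -addr_eq0; apply/eqP.
have : nop (nop (Pi x) (Pi y)) (Pi z) - T x y z
       + (nop (nop (Pi y) (Pi x)) (Pi z) - T y x z) = 0.
  rewrite Exy Eyx muln1 expr1; lmod C; ring.
rewrite (B_alt y x) nopNl => E0; rewrite -[RHS]oppr0 -{}E0; lmod C; ring.
Qed.

(** [X a] is ad a applied to Σ_m F_m ⊗ E_m, and [D a] is the commutator of σ with ad a. [Q a] and -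
    (i/k) Π([M a]) will be the coefficients of 1 and χ in [J_Λ Πa]. *)
Let X a := \sum_m (B (qlie a (F m)) (E m) + B (F m) (qlie a (E m))).
Let D a b := sg (qlie a b) - qlie a (sg b).
Let M a := k *: sg a + 2 *: qlie u a.
Let Q a := (i / k) *: X a - i *: SD (Pi (sg a)).

Let B_even x y : homog false (B x y).
Proof. exact: (nop_even (Pi_odd x) (Pi_odd y)). Qed.

Let X_even a : homog false (X a).
Proof. by apply: homog_sumr => m; apply: homogD; exact: B_even. Qed.

Let Q_even a : homog false (Q a).
Proof.
apply: homogD; first exact: homogZ (X_even a).
by apply: homogN; apply: homogZ; exact: SD_odd (Pi_odd _).
Qed.

Let br_Pi_B a b c :
  [/\ br (Pi a) (B b c) (0%N, false) = B (qlie a b) c + B b (qlie a c),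
      br (Pi a) (B b c) (0%N, true) = Pi ((k * qform a b) *: c - (k * qform a c) *: b),
      br (Pi a) (B b c) (1%N, false) = (k * qform (qlie a b) c) *: vac V &
      forall n j, (n, j) \notin low -> br (Pi a) (B b c) (n, j) = 0].
Proof.
have W := wick_coef (Pi c) _ _ (Pi_odd a) (Pi_odd b).
split=> [|||n j nj].
- by rewrite W big_ord0 !br_Pi /=; lmod C; ring.
- by rewrite W big_ord0 !br_Pi /= nopZl nop_vacl nopZr nop_vacr !linE; lmod C; ring.
- by rewrite W big_ord1 !br_Pi /= nop0l linear0 subn0 invr1; lmod C; ring.
- rewrite W; case: n nj => [|n] nj; first by case: j nj.
  rewrite !br_Pi nop0l linear0 scaler0 !add0r big1 // => -[[|m] mn] _ /=; last first.
    by rewrite br_Pi br0l scaler0.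
  rewrite !br_Pi subn0; case: j nj => nj.
    by rewrite brZl br_vacl scaler0 scaler0.
  by case: n nj {mn} => //= n nj; rewrite br_Pi scaler0.
Qed.


Let D_sum a b : D a b = \sum_m (- qform b (qlie a (F m)) *: E m + qform b (qlie a (E m)) *: F m
   - qform b (F m) *: qlie a (E m) + qform b (E m) *: qlie a (F m)).
Proof.
rewrite /D !lsign_def /lproj lieDr lieNr !lie_sumr -!sumrB.
by apply: eq_bigr => m _; rewrite !qform_ad !lieZr; lmod C; ring.
Qed.

(** The λ-coefficient is only needed up to a scalar s: skew-symmetry applies T to it, which kills
    the vacuum. *)
Let br_Pi_X a b :
  [/\ br (Pi b) (X a) (0%N, false) = ad_sum E F Bf b a,
      br (Pi b) (X a) (0%N, true) = - (k *: Pi (D a b)),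
      exists s, br (Pi b) (X a) (1%N, false) = s *: vac V &
      forall n j, (n, j) \notin low -> br (Pi b) (X a) (n, j) = 0].
Proof.
split=> [|||n j nj].
- rewrite br_sumr; apply: eq_bigr => m _; rewrite brDr.
  by have [-> _ _ _] := br_Pi_B b (qlie a (F m)) (E m);
     have [-> _ _ _] := br_Pi_B b (F m) (qlie a (E m)).
- rewrite br_sumr D_sum linear_sum scaler_sumr -sumrN; apply: eq_bigr => m _; rewrite brDr.
  have [_ -> _ _] := br_Pi_B b (qlie a (F m)) (E m).
  have [_ -> _ _] := br_Pi_B b (F m) (qlie a (E m)).
  by rewrite !linE; lmod C; ring.
- exists (\sum_m (k * qform (qlie b (qlie a (F m))) (E m)
                  + k * qform (qlie b (F m)) (qlie a (E m)))).
  rewrite br_sumr scaler_suml; apply: eq_bigr => m _; rewrite brDr scalerDl.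
  by have [_ _ -> _] := br_Pi_B b (qlie a (F m)) (E m);
     have [_ _ -> _] := br_Pi_B b (F m) (qlie a (E m)).
- rewrite br_sumr big1 // => m _; rewrite brDr.
  have [_ _ _ ->] := br_Pi_B b (qlie a (F m)) (E m) => //.
  by have [_ _ _ ->] := br_Pi_B b (F m) (qlie a (E m)); rewrite ?addr0.
Qed.

Let br_X_Pi a b :
  [/\ br (X a) (Pi b) (0%N, false) = ad_sum E F Bf b a + k *: SD (Pi (D a b)),
      br (X a) (Pi b) (0%N, true) = k *: Pi (D a b) &
      forall n, br (X a) (Pi b) (n.+1, true) = 0].
Proof.
have [E00 E01 [s E10] Elow] := br_Pi_X a b.
have [-> -> _ low0] := br_skew_low (X_even a) (Pi_odd b) Elow.
have TD_vac : TD (s *: vac V) = 0 by rewrite /TD !SDZ SD_vac linear0 scaler0.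
rewrite mul0n expr0 !scale1r E00 E01 E10 TD_vac SDN SDZ.
split=> [||n].
- by lmod C; ring.
- by lmod C; ring.
- by rewrite low0 //; case: n.
Qed.

(** * Brackets of J with generators and products *)

Let J := (i / k) *: (\sum_j B (F j) (E j)) - (2 / k) *: SD (i *: Pi u).

Let J_even : homog false J.
Proof.
apply: homogD; first by apply: homogZ; apply: homog_sumr => j; exact: B_even.
by apply: homogN; apply: homogZ; exact: SD_odd (homogZ _ (Pi_odd _)).
Qed.

Let sum_FE : \sum_j qlie (F j) (E j) = 2 *: u.
Proof.
by rewrite -[RHS]opprK -sum_EF -sumrN; apply: eq_bigr => j _; rewrite lieC.
Qed.

(** In degree λ the quadratic part gives (i/k) k (a | Σ_m [F_m, E_m]) = 2i (a|u), and the term in Su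
    cancels it. *)
Let br_Pi_J a :
  [/\ br (Pi a) J (0%N, false) = (i / k) *: X a - (2 * i / k) *: SD (Pi (qlie a u)),
      br (Pi a) J (0%N, true) = (i / k) *: Pi (k *: sg a - 2 *: qlie a u),
      br (Pi a) J (1%N, false) = 0 &
      forall n j, (n, j) \notin low -> br (Pi a) J (n, j) = 0].
Proof.
have S0 : br (Pi a) (SD (Pi u)) (0%N, false) = SD (Pi (qlie a u)).
  by rewrite (br_SDr_false0 _ (Pi_odd a)) br_Pi; lmod C; ring.
have S1 n : br (Pi a) (SD (Pi u)) (n, true) = if n is 0 then Pi (qlie a u) else 0.
  rewrite (br_SDr_true _ _ (Pi_odd a)) !br_Pi.
  by case: n => [|n]; rewrite ?SDZ ?SD_vac ?linear0; lmod C; ring.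
have S2 n : br (Pi a) (SD (Pi u)) (n.+1, false) =
    if n is 0 then (k * qform a u) *: vac V else 0.
  rewrite (br_SDr_falseS _ _ (Pi_odd a)) !br_Pi linear0.
  by case: n => [|n]; lmod C; ring.
have sB := fun m => br_Pi_B a (F m) (E m).
have JE n j : br (Pi a) J (n, j) = (i / k) *: (\sum_m br (Pi a) (B (F m) (E m)) (n, j))
    - (2 * i / k) *: br (Pi a) (SD (Pi u)) (n, j).
  by rewrite /J brDr brNr !brZr SDZ brZr br_sumr; lmod C; ring.
split=> [|||n j nj]; rewrite JE.
- rewrite S0; congr (_ *: _ - _).
  by apply: eq_bigr => m _; have [-> _ _ _] := sB m.
- rewrite S1 (_ : \sum_m _ = k *: Pi (sg a)).
    by rewrite PiD PiN !PiZ; lmod C; ring.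
  rewrite lsign_def PiD PiN /lproj !Pi_sum -sumrB scaler_sumr.
  apply: eq_bigr => m _; have [_ -> _ _] := sB m.
  by rewrite PiD PiN !PiZ; lmod C; ring.
- rewrite S2 (_ : \sum_m _ = (2 * k * qform a u) *: vac V).
    by lmod C; field.
  transitivity ((k * qform a (\sum_m qlie (F m) (E m))) *: vac V).
    rewrite qform_sumr mulr_sumr scaler_suml; apply: eq_bigr => m _.
    by have [_ _ -> _] := sB m; rewrite form_invariant.
  by rewrite sum_FE qformZr; lmod C; ring.
- rewrite big1 => [|m _]; last by have [_ _ _ ->] := sB m.
  case: n nj => [|[|n]]; case: j => // _; rewrite ?S1 ?S2; by lmod C; ring.
Qed.

(** Under skew-symmetry the two contributions of u to the constant coefficient cancel, so u survives
    only in [M]. *)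
Let br_J_Pi a :
  [/\ br J (Pi a) (0%N, false) = Q a,
      br J (Pi a) (0%N, true) = - ((i / k) *: Pi (M a)) &
      forall n j, n != 0%N -> br J (Pi a) (n, j) = 0].
Proof.
have [E00 E01 E10 Elow] := br_Pi_J a.
have [-> -> J10 low0] := br_skew_low J_even (Pi_odd a) Elow.
rewrite mul0n expr0 !scale1r E00 E01 E10 /TD !SDZ !linear0.
split=> [||n j].
- rewrite /Q PiD PiN !PiZ !SDD !SDN !SDZ.
  by lmod C; field.
- rewrite /M (lieC u) PiD PiN !PiZ; rewrite PiD !PiZ PiN.
  by lmod C; ring.
- case: n => [|[|n]] // _; last by rewrite low0.
  by case: j; [rewrite low0 | rewrite J10 E10 scaler0 oppr0].
Qed.

Let br_J_Pi_high a n j : br J (Pi a) (n.+1, j) = 0.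
Proof. by have [_ _ ->] := br_J_Pi a. Qed.

(** The origin of [ldefect]: the quadratic part of [Q a] contributes [D a b], and its term in S
    contributes - [σa, b]. *)
Let br_Q_Pi a b :
  [/\ br (Q a) (Pi b) (0%N, false)
        = (i / k) *: ad_sum E F Bf b a + i *: SD (Pi (D a b)),
      br (Q a) (Pi b) (0%N, true) = i *: Pi (nu a b) &
      forall n, br (Q a) (Pi b) (n.+1, true) = 0].
Proof.
have [E00 E01 E1] := br_X_Pi a b.
rewrite /Q; split=> [||n]; rewrite brDl brNl !brZl.
- by rewrite E00 br_SDl_false0; lmod C; field.
- by rewrite E01 br_SDl_true br_Pi /ldefect /D !PiD !PiN; lmod C; field.
- by rewrite E1 br_SDl_true br_Pi; lmod C; ring.
Qed.

(* [br J] acts on products by the operators [Q] and [- (i / k) M] up to the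
   second-order term given by [nu]. *)
Let br_J_nop a (x : V) :
  [/\ br J (nop (Pi a) x) (0%N, false)
        = nop (Q a) x - nop (Pi a) (br J x (0%N, false)),
      br J (nop (Pi a) x) (0%N, true)
        = - ((i / k) *: nop (Pi (M a)) x) + nop (Pi a) (br J x (0%N, true)),
      br J (nop (Pi a) x) (1%N, false)
        = - nop (Pi a) (br J x (1%N, false)) + br (Q a) x (0%N, true) &
      br J (nop (Pi a) x) (1%N, true)
        = nop (Pi a) (br J x (1%N, true)) - (i / k) *: br (Pi (M a)) x (0%N, true)].
Proof.
have W := wick_coef x _ _ J_even (Pi_odd a).
have [J00 J01 Jlow] := br_J_Pi a.
split; rewrite W ?big_ord0 ?big_ord1 /= ?subn0 ?J00 ?J01 ?Jlow //
  ?nop0l ?brNl ?brZl ?nopNl ?nopZl ?invr1; lmod C; ring.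
Qed.

Let br_J_high a (x : V) n j :
  br J x (n.+2, j) = 0 ->
  (forall n, br (Q a) x (n.+1, true) = 0) ->
  (forall n, br (Pi (M a)) x (n.+1, true) = 0) ->
  br J (nop (Pi a) x) (n.+2, j) = 0.
Proof.
move=> Jx Qx Mx; have [J00 J01 Jlow] := br_J_Pi a.
rewrite (wick_coef x _ _ J_even (Pi_odd a)) Jx Jlow // nop0l linear0 scaler0 !add0r.
rewrite big1 // => -[[|m] mn] _ /=; last by rewrite Jlow // br0l scaler0.
rewrite subn0; case: j {Jx}; first by rewrite J01 brNl brZl Mx scaler0 oppr0 scaler0.
by rewrite J00 Qx scaler0.
Qed.

Let br_J_SD (x : V) :
  [/\ br J (SD x) (0%N, false) = - SD (br J x (0%N, false)),
      br J (SD x) (0%N, true) = SD (br J x (0%N, true)) - br J x (0%N, false),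
      br J (SD x) (1%N, false) = - (SD (br J x (1%N, false)) + br J x (0%N, true)) &
      br J (SD x) (1%N, true) = SD (br J x (1%N, true)) - br J x (1%N, false)].
Proof.
split; rewrite ?(br_SDr_true _ _ J_even) ?(br_SDr_false0 _ J_even)
  ?(br_SDr_falseS _ _ J_even) expr0 scale1r //.
Qed.

(** * The vector H and the bracket of J with itself *)

Let EXF := \sum_j nop (Pi (E j)) (X (F j)).
Let FXE := \sum_j nop (Pi (F j)) (X (E j)).
Let ESF := \sum_j nop (Pi (E j)) (SD (Pi (F j))).
Let FSE := \sum_j nop (Pi (F j)) (SD (Pi (E j))).
Let BFE := \sum_j B (F j) (E j).
Let cubic := \sum_j \sum_m
  (T (E j) (F m) (qlie (F j) (E m)) + T (F j) (E m) (qlie (E j) (F m))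
   - T (E j) (E m) (qlie (F j) (F m)) - T (F j) (F m) (qlie (E j) (E m))).
Let H := k^-1 *: \sum_j (nop (Pi (E j)) (SD (Pi (F j))) + nop (Pi (F j)) (SD (Pi (E j))))
  + (k ^+ 2)^-1 *: cubic.

Let H_odd : homog true H.
Proof.
have T_odd x y z : homog true (T x y z) := nop_even (Pi_odd x) (B_even y z).
have S_even x : homog false (SD (Pi x)) := SD_odd (Pi_odd x).
apply: homogD; apply: homogZ; apply: homog_sumr => j.
  by apply: homogD; exact: nop_even (Pi_odd _) (S_even _).
by apply: homog_sumr => m; do !apply: homogD; rewrite ?T_odd //; apply: homogN.
Qed.

Let H_sums : H = k^-1 *: (ESF + FSE) + (k ^+ 2)^-1 *: cubic.
Proof. by rewrite /H big_split. Qed.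

Let cubic_sums : cubic = EXF - FXE.
Proof.
rewrite /cubic /EXF /FXE -sumrB; apply: eq_bigr => j _.
rewrite /X !nop_sumr -sumrB; apply: eq_bigr => m _ /=.
rewrite !nopDr (T23 (E j) (qlie _ _)) (T23 (F j) (qlie _ _)); lmod C; ring.
Qed.

Let X_u : X u = 0.
Proof. by rewrite /X big_split; exact: (ad_invariantFE uE_closed uF_closed B_bilinear). Qed.

Let Q_u : Q u = - (i *: SD (Pi (sg u))).
Proof. by rewrite /Q X_u scaler0 add0r. Qed.

Let M_u : M u = k *: sg u.
Proof. by rewrite /M lie_alt scaler0 addr0. Qed.

Let QE j : Q (E j) = (i / k) *: X (E j) - i *: SD (Pi (E j)).
Proof. by rewrite /Q lsignE. Qed.

Let QF j : Q (F j) = (i / k) *: X (F j) + i *: SD (Pi (F j)).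
Proof. by rewrite /Q lsignF // PiN SDN scalerN opprK. Qed.

Let nop_X_Pi a b : nop (X a) (Pi b) = nop (Pi b) (X a) + k *: TD (Pi (D a b)).
Proof.
have [_ X01 X1] := br_X_Pi a b.
by rewrite (quasicomm_low (X_even a) (Pi_odd b) X1) X01 scale1r /TD !SDZ.
Qed.

Let nop_SD_Pi a b :
  nop (SD (Pi a)) (Pi b) = nop (Pi b) (SD (Pi a)) + TD (Pi (qlie a b)).
Proof.
rewrite (quasicomm_low (SD_odd (Pi_odd a)) (Pi_odd b)) => [|n].
  by rewrite br_SDl_true br_Pi scale1r.
by rewrite br_SDl_true br_Pi.
Qed.

Let nop_QF j : nop (Q (F j)) (Pi (E j)) =
  (i / k) *: nop (Pi (E j)) (X (F j)) + i *: nop (Pi (E j)) (SD (Pi (F j)))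
  + i *: TD (Pi (sg (qlie (F j) (E j)))).
Proof.
rewrite QF nopDl !nopZl nop_X_Pi nop_SD_Pi /D lsignE //.
by rewrite PiD PiN /TD !SDD !SDN; lmod C; field.
Qed.

Let sum_TD_FE : \sum_j TD (Pi (sg (qlie (F j) (E j)))) = 2 *: TD (Pi (sg u)).
Proof.
by rewrite /TD -!SD_sum -Pi_sum -linear_sum sum_FE /= lsignZ PiZ !SDZ.
Qed.

Let br_J_J (m : nat * bool) : br J J m =
  (i / k) *: (\sum_j br J (B (F j) (E j)) m) - (2 * i / k) *: br J (SD (Pi u)) m.
Proof. by rewrite {2}/J brDr brNr !brZr SDZ brZr br_sumr; lmod C; ring. Qed.

Let JJ00 : br J J (0%N, false) = - H.
Proof.
rewrite br_J_J; have [-> _ _ _] := br_J_SD (Pi u).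
have [-> _ _] := br_J_Pi u.
have -> : \sum_j br J (B (F j) (E j)) (0%N, false) =
    (i / k) *: (EXF - FXE) + i *: (ESF + FSE) + (2 * i) *: TD (Pi (sg u)).
  transitivity (\sum_j ((i / k) *: nop (Pi (E j)) (X (F j))
      + i *: nop (Pi (E j)) (SD (Pi (F j))) + i *: TD (Pi (sg (qlie (F j) (E j))))
      - (i / k) *: nop (Pi (F j)) (X (E j)) + i *: nop (Pi (F j)) (SD (Pi (E j))))).
    apply: eq_bigr => j _; have [-> _ _ _] := br_J_nop (F j) (Pi (E j)).
    have [-> _ _] := br_J_Pi (E j); rewrite nop_QF QE !linE.
    by lmod C; ring.
  rewrite big_split sumrB !big_split /= -!scaler_sumr sum_TD_FE.
  by rewrite -/EXF -/FXE -/ESF -/FSE; lmod C; ring.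
(* Reordering :Q(F_j) E_j: has produced T(σu) terms, which cancel against the one from Su in J. *)
rewrite Q_u SDN SDZ H_sums cubic_sums /TD.
by lmod C; field: i2.
Qed.

(** Both parts of [M] annihilate Σ_j E_j ⊗ F_j: σ because its eigenvalues on E_j and F_j are
    opposite, ad u by invariance. *)
Let sum_M (h : g -> g -> V) : bilinear_map h ->
  \sum_j h (M (E j)) (F j) = - \sum_j h (E j) (M (F j)).
Proof.
move=> bh; apply/eqP; rewrite -addr_eq0; apply/eqP.
have uh : \sum_j h (qlie u (E j)) (F j) + \sum_j h (E j) (qlie u (F j)) = 0.
  exact: (ad_invariantEF uE_closed uF_closed bh).
transitivity (2 *: (\sum_j h (qlie u (E j)) (F j) + \sum_j h (E j) (qlie u (F j)))).
  rewrite -!big_split scaler_sumr; apply: eq_bigr => j _ /=.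
  rewrite /M lsignE // lsignF // bilinear_Dl // bilinear_Dr // !bilinear_Zl //.
  by rewrite !bilinear_Zr // -[- F j]scaleN1r bilinear_Zr //; lmod C; ring.
by rewrite uh scaler0.
Qed.

Let sum_M_FE (h : g -> g -> V) : bilinear_map h ->
  \sum_j h (F j) (M (E j)) = - \sum_j h (M (F j)) (E j).
Proof. by move=> /bilinear_flip /sum_M. Qed.

Let JJ01 : br J J (0%N, true) = 0.
Proof.
rewrite br_J_J; have [_ -> _ _] := br_J_SD (Pi u).
have [-> -> _] := br_J_Pi u.
have -> : \sum_j br J (B (F j) (E j)) (0%N, true) = 0.
  transitivity (- (i / k) *: (\sum_j B (M (F j)) (E j) + \sum_j B (F j) (M (E j)))).
    rewrite -big_split scaler_sumr; apply: eq_bigr => j _ /=.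
    have [_ -> _ _] := br_J_nop (F j) (Pi (E j)); have [_ -> _] := br_J_Pi (E j).
    by rewrite !linE; lmod C; ring.
  by rewrite [X in _ + X](sum_M_FE B_bilinear) subrr scaler0.
by rewrite Q_u M_u PiZ SDN !SDZ; lmod C; field.
Qed.

Let JJ10 : br J J (1%N, false) = 0.
Proof.
rewrite br_J_J; have [_ _ -> _] := br_J_SD (Pi u).
have [_ -> Jlow] := br_J_Pi u; rewrite Jlow // linear0 add0r.
have -> : \sum_j br J (B (F j) (E j)) (1%N, false) = (2 * i) *: Pi (sg u).
  transitivity (\sum_j i *: Pi (sg (qlie (F j) (E j)))).
    apply: eq_bigr => j _; have [_ _ -> _] := br_J_nop (F j) (Pi (E j)).
    have [_ _ JElow] := br_J_Pi (E j); rewrite JElow // linear0 oppr0 add0r.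
    have [_ -> _] := br_Q_Pi (F j) (E j).
    congr (_ *: Pi _); rewrite /ldefect lsignE // lsignF // lieNl.
    by lmod C; ring.
  by rewrite -scaler_sumr -Pi_sum -linear_sum sum_FE /= lsignZ PiZ scalerA mulrC.
by rewrite M_u PiZ; lmod C; field.
Qed.

(** The central charge: in Σ_j (M F_j | E_j), σ contributes -k for each j, and ad u contributes 2 (u
    | Σ_j [F_j, E_j]) = 4 (u|u). *)
Let JJ11 : br J J (1%N, true) = - ((d%:R - 4 / k * qform u u) *: vac V).
Proof.
rewrite br_J_J; have [_ _ _ ->] := br_J_SD (Pi u).
have [_ _ Jlow] := br_J_Pi u; rewrite !Jlow // linear0 subr0 scaler0 subr0.
transitivity ((i / k) *: \sum_j (- i * qform (M (F j)) (E j)) *: vac V).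
  congr (_ *: _); apply: eq_bigr => j _.
  have [_ _ _ ->] := br_J_nop (F j) (Pi (E j)); have [_ _ JElow] := br_J_Pi (E j).
  by rewrite JElow // br_Pi linear0; lmod C; field.
rewrite -scaler_suml -mulr_sumr.
have -> : \sum_j qform (M (F j)) (E j) = - (k * d%:R) + 4 * qform u u.
  transitivity (\sum_j (- k + 2 * qform u (qlie (F j) (E j)))).
    apply: eq_bigr => j _; rewrite /M lsignF // qformDl !qformZl form_invariant.
    by rewrite -[- F j]scaleN1r qformZl (form_sym (F j) (E j)) EF_dual eqxx /=; ring.
  rewrite big_split sumr_const card_ord -mulr_sumr -qform_sumr sum_FE qformZr /=.
  by rewrite -mulr_natr; ring.
by lmod C; field: i2.
Qed.

Let JJ_high n j : br J J (n.+2, j) = 0.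
Proof.
rewrite br_J_J big1 => [|m _].
  by case: j; rewrite ?(br_SDr_true _ _ J_even) ?(br_SDr_falseS _ _ J_even)
    !br_J_Pi_high SD0; lmod C; ring.
have [_ _ Jlow] := br_J_Pi (E m).
apply: br_J_high; first by rewrite Jlow.
  by have [] := br_Q_Pi (F m) (E m).
by move=> n'; rewrite br_Pi.
Qed.

(** * The bracket of J with H *)

Let br_J_T01 x y z :
  br J (T x y z) (0%N, true) = - (i / k) *: derT Tf M x y z.
Proof.
have [_ -> _ _] := br_J_nop x (B y z); have [_ -> _ _] := br_J_nop y (Pi z).
have [_ -> _] := br_J_Pi z.
by rewrite /derT !(nopDr, nopNr, nopZr); lmod C; ring.
Qed.

(** The pairings of x with y and with z come from the Wick formula for Q(x) and :yz:; that of y with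
    z comes from J acting on :yz:. *)
Let br_J_T10 x y z : br J (T x y z) (1%N, false) = i *: second_order E F Bf x y z.
Proof.
have [_ _ -> _] := br_J_nop x (B y z); have [_ _ -> _] := br_J_nop y (Pi z).
have [_ Qyz _] := br_Q_Pi y z; have [_ Qxy _] := br_Q_Pi x y; have [_ Qxz _] := br_Q_Pi x z.
rewrite br_J_Pi_high linear0 Qyz (wick_coef _ _ _ (Q_even x) (Pi_odd y)) big_ord0.
rewrite Qxy Qxz /second_order (ldefectC E F z x) PiN !(nopNr, nopNl, nopZl, nopZr, oppr0, add0r).
rewrite (B_alt x) (B_alt y); lmod C; ring.
Qed.

Let br_J_aSb01 a b : br J (nop (Pi a) (SD (Pi b))) (0%N, true) =
  - (i / k) *: (nop (Pi (M a)) (SD (Pi b)) + nop (Pi a) (SD (Pi (M b))))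
  - nop (Pi a) (Q b).
Proof.
have [_ -> _ _] := br_J_nop a (SD (Pi b)); have [_ -> _ _] := br_J_SD (Pi b).
have [-> -> _] := br_J_Pi b.
by rewrite SDN SDZ !(nopDr, nopNr, nopZr); lmod C; ring.
Qed.

Let br_J_aSb10 a b : br J (nop (Pi a) (SD (Pi b))) (1%N, false) =
  - (i / k) *: (B a (M b) + ad_sum E F Bf b a) - i *: SD (Pi (qlie (sg a) b)).
Proof.
have [_ _ -> _] := br_J_nop a (SD (Pi b)); have [_ _ -> _] := br_J_SD (Pi b).
have [_ -> Jlow] := br_J_Pi b; have [Q00 Q01 _] := br_Q_Pi a b.
rewrite Jlow // (br_SDr_true _ _ (Q_even a)) Q00 Q01 SD0 add0r opprK nopZr SDZ.
by rewrite /ldefect -/(D a b) /D !PiD !PiN !SDD !SDN; lmod C; ring.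
Qed.

Let br_J_H m : br J H m =
  k^-1 *: (\sum_j br J (nop (Pi (E j)) (SD (Pi (F j)))) m
           + \sum_j br J (nop (Pi (F j)) (SD (Pi (E j)))) m)
  + (k ^+ 2)^-1 *: \sum_j \sum_m'
    (br J (T (E j) (F m') (qlie (F j) (E m'))) m
     + br J (T (F j) (E m') (qlie (E j) (F m'))) m
     - br J (T (E j) (E m') (qlie (F j) (F m'))) m
     - br J (T (F j) (F m') (qlie (E j) (E m'))) m).
Proof.
rewrite /H brDr !brZr br_sumr -big_split /cubic br_sumr.
congr (_ *: _ + _ *: _); apply: eq_bigr => j _; first by rewrite brDr.
by rewrite br_sumr; apply: eq_bigr => m' _; rewrite !(brDr, brNr).
Qed.

(** Reordering :(S F_j) E_j: gives T[F_j, E_j], whose sum 2 Tu cancels the derivative of the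
    correction term of J. *)
Let SD_J : SD J = (i / k) *: (ESF - FSE).
Proof.
rewrite /J SDD SDN !SDZ SD_sum.
have -> : \sum_m SD (B (F m) (E m)) = ESF + 2 *: TD (Pi u) - FSE.
  transitivity (\sum_j (nop (Pi (E j)) (SD (Pi (F j))) + TD (Pi (qlie (F j) (E j)))
                        - nop (Pi (F j)) (SD (Pi (E j))))).
    apply: eq_bigr => j _; rewrite (nop_SD _ (Pi_odd _)) nop_SD_Pi.
    by lmod C; ring.
  rewrite sumrB big_split /=; congr (_ + _ - _).
  by rewrite /TD -!SD_sum -Pi_sum sum_FE PiZ !SDZ.
by rewrite /TD; lmod C; field.
Qed.

Let JH01 : br J H (0%N, true) = - SD J.
Proof.
have M_sum : \sum_j (nop (Pi (M (E j))) (SD (Pi (F j))) + nop (Pi (E j)) (SD (Pi (M (F j)))))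
    + \sum_j (nop (Pi (M (F j))) (SD (Pi (E j))) + nop (Pi (F j)) (SD (Pi (M (E j))))) = 0.
  have bh : bilinear_map (fun x y => nop (Pi x) (SD (Pi y))).
    by split=> ? c a b /=; rewrite !(PiD, PiZ, SDD, SDZ, nopDl, nopZl, nopDr, nopZr).
  by rewrite !big_split /= (sum_M bh) (sum_M_FE bh) addNr subrr addr0.
have der_M : der_cubic E F Tf M = - k *: (EXF + FXE).
  rewrite (der_cubicD E F T_linear T12 T23 sg (qlie u)) (der_cubic_ad _ _ T_linear) //.
  rewrite (der_cubic_lsign _ _ _ _ _ T_linear) // scaler0 addr0 scalerN scaleNr.
  congr (- (_ *: _)); rewrite /EXF /FXE -big_split; apply: eq_bigr => j _.
  rewrite /X !nop_sumr -big_split; apply: eq_bigr => m _ /=.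
  by rewrite !nopDr.
rewrite br_J_H SD_J.
transitivity (k^-1 *: (- (i / k) *: 0 - (\sum_j nop (Pi (E j)) (Q (F j)))
                      - (\sum_j nop (Pi (F j)) (Q (E j))))
  + (k ^+ 2)^-1 *: (- (i / k) *: der_cubic E F Tf M)).
  congr (_ *: _ + _ *: _).
    have sum_aSb (a b : 'I_d -> g) :
        \sum_j br J (nop (Pi (a j)) (SD (Pi (b j)))) (0%N, true) = - (i / k) *:
          (\sum_j (nop (Pi (M (a j))) (SD (Pi (b j))) + nop (Pi (a j)) (SD (Pi (M (b j))))))
          - \sum_j nop (Pi (a j)) (Q (b j)).
      by rewrite scaler_sumr -sumrB; apply: eq_bigr => j _; exact: br_J_aSb01.
    move/eqP: M_sum; rewrite addr_eq0 => /eqP M_sum.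
    by rewrite (sum_aSb E F) (sum_aSb F E) M_sum; lmod C; ring.
  rewrite scaler_sumr; apply: eq_bigr => j _; rewrite scaler_sumr; apply: eq_bigr => m _.
  by rewrite !br_J_T01; lmod C; ring.
(* The cubic part of H now contributes (i/k^2) ([EXF] + [FXE]), which cancels the [X] terms of [Q];
   the terms in S form - SJ. *)
rewrite der_M.
have -> : \sum_j nop (Pi (E j)) (Q (F j)) = (i / k) *: EXF + i *: ESF.
  rewrite /EXF /ESF !scaler_sumr -big_split; apply: eq_bigr => j _.
  by rewrite QF nopDr !nopZr.
have -> : \sum_j nop (Pi (F j)) (Q (E j)) = (i / k) *: FXE - i *: FSE.
  rewrite /FXE /FSE !scaler_sumr -sumrB; apply: eq_bigr => j _.
  by rewrite QE nopDr nopNr !nopZr.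
by lmod C; field: i2.
Qed.

Let JH10 : br J H (1%N, false) = - (2 *: J).
Proof.
pose BFuE := \sum_j B (F j) (qlie u (E j)).
pose ad := \sum_j (ad_sum E F Bf (F j) (E j) + ad_sum E F Bf (E j) (F j)).
have two_neq0 : (2 : C) != 0 := natC_neq0 1.
have cubicE := sum_delta_cubic EF_dual E_isotropic F_isotropic EE_closed FF_closed
  uE_closed uF_closed sum_EF B_bilinear B_alt two_neq0.
rewrite br_J_H.
(* By [sum_delta_cubic], [BFuE] and [ad] cancel between the quadratic and the cubic part of H. *)
transitivity (k^-1 *: (- (2 * i / k) *: (k *: BFE + 2 *: BFuE) - (i / k) *: ad
                       + (4 * i) *: SD (Pi u))
  + (k ^+ 2)^-1 *: (i *: (4 *: BFuE + ad))); last first.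
  by rewrite /J -/BFE SDZ; lmod C; field.
rewrite -cubicE; congr (_ *: _ + _ *: _); last first.
  rewrite scaler_sumr; apply: eq_bigr => j _; rewrite scaler_sumr; apply: eq_bigr => m _.
  by rewrite !br_J_T10; lmod C; ring.
have sFME : \sum_j B (F j) (M (E j)) = k *: BFE + 2 *: BFuE.
  rewrite /BFE /BFuE !scaler_sumr -big_split; apply: eq_bigr => j _.
  by rewrite /M lsignE // PiD !PiZ nopDr !nopZr.
have sEMF : \sum_j B (E j) (M (F j)) = k *: BFE + 2 *: BFuE.
  rewrite -sFME (sum_M_FE B_bilinear) -sumrN; apply: eq_bigr => j _.
  exact: B_alt.
transitivity (- (i / k) *: (\sum_j B (E j) (M (F j)) + \sum_j B (F j) (M (E j)) + ad)
    - i *: (\sum_j SD (Pi (qlie (E j) (F j))) - \sum_j SD (Pi (qlie (F j) (E j))))).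
  rewrite /ad big_split /= -!big_split -sumrB !scaler_sumr -sumrB; apply: eq_bigr => j _ /=.
  rewrite !br_J_aSb10 lsignE // lsignF // lieNl PiN SDN.
  by lmod C; ring.
rewrite sFME sEMF -!SD_sum -!Pi_sum sum_EF sum_FE PiN PiZ SDN SDZ.
by lmod C; ring.
Qed.

Lemma superaffine_N2 : N2_embedding J H (3 * (d%:R - 4 / k * qform u u)).
Proof.
apply: N2_embedding_low => //.
apply/funext => -[n j].
set c := d%:R - 4 / k * qform u u.
rewrite -[RHS]/(- (lconst H (n, j) + (3 * c / 3) *: lamM (chiM (lconst (vac V))) (n, j))).
rewrite /lamM /chiM; case: j; case: n => [|[|n]] /=;
  rewrite ?JJ00 ?JJ01 ?JJ10 ?JJ11 ?JJ_high -/c ?lconst_true /lconst /=; lmod C; field; exact: (natC_neq0 2).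
Qed.

End Superaffine.

(** * From isotropic subspaces to dual bases *)

Lemma lproj_basis (C : fieldType) (g : quadraticLie C) (U : {vspace g}) d
    (X Y : d.-tuple g) :
  basis_of U X ->
  (forall j m : 'I_d, qform (tnth X j) (tnth Y m) = (j == m)%:R) ->
  forall x, x \in U -> lproj (tnth X) (tnth Y) x = x.
Proof.
move=> basisX XY x xU; rewrite [in RHS](coord_basis basisX xU) /lproj.
apply: eq_bigr => m _; rewrite -(tnth_nth 0); congr (_ *: _).
rewrite [in LHS](coord_basis basisX xU) qform_suml (bigD1 m) //= qformZl.
rewrite -(tnth_nth 0) XY eqxx mulr1 big1 ?addr0 // => j jm.
by rewrite qformZl -(tnth_nth 0) XY (negPf jm) mulr0.
Qed.

Lemma br_enveloping (C : fieldType) (g : quadraticLie C) (k : C) (R : susyLCA C)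
    (PiR : {linear g -> R}) (K : R) (V : susyVA C) (iota : {linear R -> V}) :
  superaffine_LCA PiR K -> enveloping_VA K k iota ->
  forall a b n j, br (iota (PiR a)) (iota (PiR b)) (n, j) =
    if n is 0 then if j then (k * qform a b) *: vac V else iota (PiR (qlie a b)) else 0.
Proof.
move=> [_ _ _ _ _ _ brR] [iotaM iotaK _ _] a b n j.
rewrite -(lca_morphism_br iotaM) brR.
rewrite -[X in iota X]/(lconst (PiR (qlie a b)) (n, j) + qform a b *: chiM (lconst K) (n, j)).
case: j; case: n => [|n]; rewrite /chiM /= ?lconst_true /lconst /=.
- by rewrite add0r linearZ /= iotaK scalerA mulrC.
- by rewrite scaler0 addr0 linear0.
- by rewrite scaler0 addr0.
- by rewrite oppr0 scaler0 addr0 linear0.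
Qed.

Theorem theorem3p16
    (C : closedFieldType) (C_char0 : [pchar C] =i pred0)
    (i : C) (i2 : i ^+ 2 = -1)
    (g : quadraticLie C) (k : C) (k_neq0 : k != 0)
    (l lbar : {vspace g})
    (l_isotropic : isotropic l) (lbar_isotropic : isotropic lbar)
    (l_disjoint : (l :&: lbar = 0)%VS)
    (l_nondeg : nondeg_on (l + lbar)%VS)
    (eps epsb : (\dim l).-tuple g)
    (eps_basis : basis_of l eps) (epsb_basis : basis_of lbar epsb)
    (eps_dual : forall j m : 'I_(\dim l),
      qform (tnth eps j) (tnth epsb m) = (j == m)%:R)
    (vareps : g) (vareps_in : vareps \in (l + lbar)%VS)
    (Fterm : forall x, x \in l -> stable_by x l)
    (Fterm_bar : forall x, x \in lbar -> stable_by x lbar)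
    (Dterm : 2^-1 *: \sum_(j < \dim l) qlie (tnth eps j) (tnth epsb j)
             = daddv_pi lbar l vareps - daddv_pi l lbar vareps)
    (holomorphic : stable_by vareps l)
    (holomorphic_bar : stable_by vareps lbar)
    (V : susyVA C) (Pi : g -> V)
    (V_superaffine : universal_superaffine_VA k Pi) :
  let e_ (j : 'I_(\dim l)) := Pi (tnth eps j) in
  let e' (j : 'I_(\dim l)) := Pi (tnth epsb j) in
  let u := Pi (daddv_pi l lbar vareps - daddv_pi lbar l vareps) in
  let J := (i / k) *: (\sum_j nop (e' j) (e_ j)) - (2 / k) *: SD V (i *: u) in
  let H :=
    k^-1 *: (\sum_j (nop (e_ j) (SD V (e' j)) + nop (e' j) (SD V (e_ j))))
    + (k ^+ 2)^-1 *: (\sum_j \sum_m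
        (  nop (e_ j) (nop (e' m) (Pi (qlie (tnth epsb j) (tnth eps m))))
         + nop (e' j) (nop (e_ m) (Pi (qlie (tnth eps j) (tnth epsb m))))
         - nop (e_ j) (nop (e_ m) (Pi (qlie (tnth epsb j) (tnth epsb m))))
         - nop (e' j) (nop (e' m) (Pi (qlie (tnth eps j) (tnth eps m)))))) in
  N2_embedding J H (3 * ((\dim l)%:R + 4 / k * qform vareps vareps)).
Proof.
have [R [PiR [K [iota [sR sV PiE]]]]] := V_superaffine.
have two_neq0 : (2 : C) != 0 by rewrite (pcharf0P C).1.
pose Pi' : {linear g -> V} := iota \o PiR.
have {PiE} -> : Pi = Pi' by apply/funext.
set a := daddv_pi l lbar vareps in Dterm *.
set b := daddv_pi lbar l vareps in Dterm *.
have al : a \in l := memv_pi _ _ _.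
have bl : b \in lbar := memv_pi _ _ _.
have ab : a + b = vareps := daddv_pi_add l_disjoint vareps_in.
have epsl j : tnth eps j \in l by rewrite (basis_mem eps_basis) ?mem_tnth.
have epsbl j : tnth epsb j \in lbar by rewrite (basis_mem epsb_basis) ?mem_tnth.
have dual' j m : qform (tnth epsb j) (tnth eps m) = (j == m)%:R.
  by rewrite form_sym eps_dual eq_sym.
have lE x : x \in l -> lproj (tnth eps) (tnth epsb) x = x := lproj_basis eps_basis eps_dual (x := x).
have lF x : x \in lbar -> lproj (tnth epsb) (tnth eps) x = x := lproj_basis epsb_basis dual' (x := x).
(* By isotropy only the cross terms (a|b) remain, and they change sign with b. *)
have -> : qform vareps vareps = - qform (a - b) (a - b).
  rewrite -ab -scaleN1r !qformDl !qformDr !qformZl !qformZr.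
  by rewrite (l_isotropic _ _ al al) (lbar_isotropic _ _ bl bl) (form_sym b a); ring.
have -> : (\dim l)%:R + 4 / k * - qform (a - b) (a - b)
    = (\dim l)%:R - 4 / k * qform (a - b) (a - b) by ring.
apply: (superaffine_N2 C_char0 i2 k_neq0 (Pi := Pi')).
- by move=> x; apply: (lca_morphism_homog (env_morphism sV)); exact: Pi_odd sR _.
- exact: br_enveloping sR sV.
- exact: eps_dual.
- by move=> j m; apply: l_isotropic.
- by move=> j m; apply: lbar_isotropic.
- by move=> j m; apply: lE; apply: Fterm.
- by move=> j m; apply: lF; apply: Fterm_bar.
- move=> j; apply: lE.
  (* In this form both summands preserve l: a lies in l, and the other is holomorphic. For lbar, b
     takes the place of a. *)
  have -> : a - b = 2 *: a - vareps by rewrite -ab; lmod C; ring.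
  rewrite lieDl lieZl lieNl rpredB ?rpredZ //; first exact: (Fterm a al).
  exact: holomorphic.
- move=> j; apply: lF.
  have -> : a - b = vareps - 2 *: b by rewrite -ab; lmod C; ring.
  rewrite lieDl lieNl lieZl rpredB ?rpredZ //; first exact: holomorphic_bar.
  exact: (Fterm_bar b bl).
- apply: (scalerI (invr_neq0 two_neq0)); rewrite Dterm.
  by lmod C; field.
Qed.
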